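(* Let $(R,\mathfrak m)$ be a commutative Noetherian local ring, $M$ a finitely generated $R$-module of dimension $d$, $\underline x=(x_1,\ldots,x_d)$ a system of parameters of $M$, $n_0$ a positive integer, and $0\le k\le d$. Then the $k$-th Euler-Poincaré characteristic $\chi_k(x_1^{n_1},\ldots,x_d^{n_d};M)$ is a polynomial in $(n_1,\ldots,n_d)$ for all $n_1,\ldots,n_d\ge n_0$ (that is, there is a polynomial in $d$ variables whose value at $(n_1,\ldots,n_d)$ equals $\chi_k(x_1^{n_1},\ldots,x_d^{n_d};M)$ whenever all $n_i\ge n_0$) if and only if $$(0:x_i^{n_i})_{H_{k-1}(x_1^{n_1},\ldots,x_{i-1}^{n_{i-1}},x_{i+1}^{n_{i+1}},\ldots,x_d^{n_d};M)}=(0:x_i^{n_0})_{H_{k-1}(x_1^{n_1},\ldots,x_{i-1}^{n_{i-1}},x_{i+1}^{n_{i+1}},\ldots,x_d^{n_d};M)}$$ for all $i=1,\ldots,d$ and all $n_1,\ldots,n_d\ge n_0$.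
   Context: $\ell(N)$ denotes the length of an $R$-module $N$. For a sequence $\underline y$ of elements of $\mathfrak m$, $H_i(\underline y;M)$ is the $i$-th Koszul homology module of $M$ with respect to $\underline y$ (for the empty sequence $H_0(\emptyset;M)=M$; $H_{-1}=0$). For a system of parameters $\underline x$ of $M$, the $k$-th Euler-Poincaré characteristic is $\chi_k(\underline x;M)=\sum_{i\ge k}(-1)^{i-k}\ell(H_i(\underline x;M))$. For an $R$-module $N$ and $x\in R$, $(0:x)_N=\{a\in N: xa=0\}$. *)

(* Defs.v *)
From HB Require Import structures.
From mathcomp Require Import all_boot all_order all_algebra.
From mathcomp Require Import boolp.
From mathcomp Require Import mpoly.

Set Implicit Arguments.
Unset Strict Implicit.
Unset Printing Implicit Defensive.

Import GRing.Theory.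
Local Open Scope ring_scope.
Local Open Scope quotient_scope.

(* Submodules and ideals are {pred _}; through the `[< _ >] of boolp every    *)
(* subset is of this form.  MathComp's idealr_closed denotes a PROPER ideal,  *)
(* while the submodules of R^o are all the ideals of R.                       *)

(* c 0 < c 1 < ... < c l, a chain of length l of predicates satisfying P; the *)
(* values of c beyond l are irrelevant.                                       *)
Definition has_chain (T : Type) (P : {pred T} -> Prop) (l : nat) : Prop :=
  exists c : nat -> {pred T},
    (forall i, (i <= l)%N -> P (c i)) /\
    (forall i, (i < l)%N ->
       {subset c i <= c i.+1} /\ ~ {subset c i.+1 <= c i}).

Definition max_chain_length (T : Type) (P : {pred T} -> Prop) (l : nat) : Prop :=
  has_chain P l /\ forall l', has_chain P l' -> (l' <= l)%N.

Section Modules.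
Variable R : comNzRingType.

Definition fin_gen (V : lmodType R) (S : {pred V}) : Prop :=
  exists (r : nat) (g : 'I_r -> V),
    forall v, v \in S <-> exists a : 'I_r -> R, v = \sum_(i < r) a i *: g i.

Definition fg_module (M : lmodType R) : Prop := @fin_gen M predT.

Definition noetherian : Prop :=
  forall I : {pred R^o}, submod_closed I -> fin_gen I.

Definition maximal_ideal (m : {pred R}) : Prop :=
  idealr_closed m /\
  forall J : {pred R}, idealr_closed J -> {subset m <= J} -> {subset J <= m}.

Definition local_ring (m : {pred R}) : Prop :=
  maximal_ideal m /\ forall J : {pred R}, maximal_ideal J -> J =i m.

Definition prime_ideal (p : {pred R}) : Prop :=
  idealr_closed p /\ prime_idealr_closed p.

Definition annihilator (M : lmodType R) : {pred R} :=
  fun a => `[< forall v : M, a *: v = 0 >].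

(* dim M = d, that is dim (R / Ann M) = d, which is the dimension of the      *)
(* support when M is finitely generated.  No d satisfies this when M = 0.     *)
Definition krull_dim (M : lmodType R) (d : nat) : Prop :=
  max_chain_length
    (fun p : {pred R} => prime_ideal p /\ {subset annihilator M <= p}) d.

Definition is_length (N : lmodType R) (l : nat) : Prop :=
  max_chain_length (fun S : {pred N} => submod_closed S) l.

Definition finite_length (N : lmodType R) : Prop := exists l, is_length N l.

(* 0 by convention when N does not have finite length *)
Definition mod_length (N : lmodType R) : nat :=
  if pselect (finite_length N) is left h then sval (cid h) else 0%N.

(* (0 : x)_N *)
Definition colon0 (N : lmodType R) (x : R) : {pred N} := fun a => x *: a == 0.

Section QuotientModule.
Variables (V : lmodType R) (I : submodClosed V).

(* A submodClosed predicate is not inferred to be closed under subtraction,   *)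
(* because that structure is shared with semimodules.                         *)
Definition submod_zmod : V -> bool := fun v => v \in I.
HB.instance Definition _ := GRing.isZmodClosed.Build V submod_zmod
  (GRing.submod_closedB (submodClosedP I)).

Definition quotmod := Quotient.quot (GRing.ZmodClosed.clone V submod_zmod _).
HB.instance Definition _ := GRing.Zmodule.on quotmod.
HB.instance Definition _ := EqQuotient.on quotmod.

Definition quotmod_scale (a : R) (u : quotmod) : quotmod :=
  \pi_quotmod (a *: repr u).

Lemma quotmod_eqP (u v : V) : reflect (\pi_quotmod u = \pi_quotmod v) (u - v \in I).
Proof. by rewrite -[_ \in _]/(_ \in submod_zmod) Quotient.idealrBE; exact: eqP. Qed.

Lemma quotmod_piZ a u : quotmod_scale a (\pi_quotmod u) = \pi_quotmod (a *: u).
Proof.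
apply/quotmod_eqP; rewrite -scalerBr rpredZ //; apply/quotmod_eqP.
exact: reprK.
Qed.

Lemma quotmod_piD u v : \pi_quotmod u + \pi_quotmod v = \pi_quotmod (u + v).
Proof. by rewrite (Quotient.pi_add (GRing.ZmodClosed.clone V submod_zmod _)). Qed.

Lemma quotmod_scaleA a b u :
  quotmod_scale a (quotmod_scale b u) = quotmod_scale (a * b) u.
Proof. by rewrite -[u]reprK !quotmod_piZ scalerA reprK. Qed.

Lemma quotmod_scale1 : left_id 1 quotmod_scale.
Proof. by move=> u; rewrite -[u]reprK quotmod_piZ scale1r. Qed.

Lemma quotmod_scaleDr : right_distributive quotmod_scale +%R.
Proof.
move=> a u v; rewrite -[u]reprK -[v]reprK.
by rewrite quotmod_piD !quotmod_piZ quotmod_piD scalerDr.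
Qed.

Lemma quotmod_scaleDl u : {morph quotmod_scale^~ u : a b / a + b}.
Proof.
by move=> a b; rewrite -[u]reprK !quotmod_piZ quotmod_piD scalerDl.
Qed.

HB.instance Definition _ := GRing.Zmodule_isLmodule.Build R quotmod
  quotmod_scaleA quotmod_scale1 quotmod_scaleDr quotmod_scaleDl.

End QuotientModule.

(* (x_1, ..., x_n) M *)
Definition seq_submod (n : nat) (x : 'I_n -> R) (M : lmodType R) : M -> bool :=
  fun v => `[< exists w : 'I_n -> M, v = \sum_(i < n) x i *: w i >].

Lemma seq_submod_closed n (x : 'I_n -> R) (M : lmodType R) :
  subsemimod_closed (@seq_submod n x M).
Proof.
split; first split.
- by apply/asboolP; exists (fun=> 0); rewrite big1 // => i _; rewrite scaler0.
- move=> u v /asboolP[w1 ->] /asboolP[w2 ->]; apply/asboolP.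
  exists (fun i => w1 i + w2 i); rewrite -big_split.
  by apply: eq_bigr => i _; rewrite scalerDr.
- move=> a v /asboolP[w ->]; apply/asboolP; exists (fun i => a *: w i).
  by rewrite scaler_sumr; apply: eq_bigr => i _; rewrite !scalerA mulrC.
Qed.

HB.instance Definition _ n (x : 'I_n -> R) (M : lmodType R) :=
  GRing.isSubmodClosed.Build R M (@seq_submod n x M) (seq_submod_closed x M).

Definition system_of_parameters (m : {pred R}) (M : lmodType R) (d : nat)
    (x : 'I_d -> R) : Prop :=
  [/\ krull_dim M d, forall i, x i \in m
    & finite_length
        (quotmod (GRing.SubmodClosed.clone R M (@seq_submod d x M) _))].

Section Koszul.
Variables (n : nat) (y : 'I_n -> R) (M : lmodType R).

(* The graded module M (x) Lambda(R^n): the value of f at {j_1 < ... < j_p}   *)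
(* is the coefficient of e_{j_1} /\ ... /\ e_{j_p}, in degree p.              *)
Definition koszul : Type := {ffun {set 'I_n} -> M}.
HB.instance Definition _ := GRing.Lmodule.on koszul.

Definition koszul_homog (i : int) (f : koszul) : bool :=
  [forall J : {set 'I_n}, ((#|J|)%:Z != i) ==> (f J == 0)].

(* d (v e_{j_1} /\ ... /\ e_{j_p})                                            *)
(*   = \sum_r (-1)^(r-1) y_{j_r} v e_{j_1} /\ ... omit e_{j_r} ... /\ e_{j_p} *)
Definition koszul_d (f : koszul) : koszul :=
  [ffun J : {set 'I_n} =>
     \sum_(j | j \notin J)
        ((-1) ^+ #|[set l in J | (l < j)%N]| * y j) *: f (j |: J)].

Lemma koszul_homogP i (f : koszul) :
  reflect (forall J : {set 'I_n}, (#|J|)%:Z <> i -> f J = 0) (koszul_homog i f).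
Proof.
apply: (iffP forallP) => fi J.
  by move=> /eqP Ji; apply/eqP; apply: (implyP (fi J)).
by apply/implyP => /eqP Ji; rewrite fi.
Qed.

Lemma koszul_d_is_linear : linear koszul_d.
Proof.
move=> a f g; apply/ffunP => J; rewrite !ffunE scaler_sumr -big_split.
apply: eq_bigr => j _; rewrite !ffunE scalerDr; congr (_ + _).
by rewrite !scalerA mulrC.
Qed.

HB.instance Definition _ :=
  GRing.isLinear.Build R koszul koszul *:%R koszul_d koszul_d_is_linear.

Lemma koszul_homog_closed i : subsemimod_closed (koszul_homog i).
Proof.
split; first split.
- by apply/koszul_homogP => J _; rewrite ffunE.
- move=> f g /koszul_homogP f0 /koszul_homogP g0; apply/koszul_homogP => J Ji.
  by rewrite ffunE f0 // g0 // addr0.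
- move=> a f /koszul_homogP f0; apply/koszul_homogP => J Ji.
  by rewrite ffunE f0 // scaler0.
Qed.

HB.instance Definition _ i :=
  GRing.isSubmodClosed.Build R koszul (koszul_homog i) (koszul_homog_closed i).

Definition koszul_cycle (i : int) : koszul -> bool :=
  fun f => (f \in koszul_homog i) && (koszul_d f == 0).

Lemma koszul_cycle_closed i : subsemimod_closed (koszul_cycle i).
Proof.
split; first split.
- by apply/andP; split; rewrite ?rpred0 // linear0.
- move=> f g /andP[fi /eqP f0] /andP[gi /eqP g0]; apply/andP.
  by split; [rewrite rpredD | rewrite linearD /= f0 g0 addr0].
- move=> a f /andP[fi /eqP f0]; apply/andP.
  by split; [rewrite rpredZ | rewrite linearZ /= f0 scaler0].
Qed.

HB.instance Definition _ i :=
  GRing.isSubmodClosed.Build R koszul (koszul_cycle i) (koszul_cycle_closed i).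

Record koszul_cycles (i : int) := KoszulCycle {
  koszul_cycle_val :> koszul;
  _ : koszul_cycle_val \in koszul_cycle i
}.

HB.instance Definition _ i := [isSub of koszul_cycles i for @koszul_cycle_val i].
HB.instance Definition _ i := [Choice of koszul_cycles i by <:].
HB.instance Definition _ i := [SubChoice_isSubLmodule of koszul_cycles i by <:].

Definition koszul_boundary (i : int) : koszul_cycles i -> bool :=
  fun z => `[< exists2 w : koszul, w \in koszul_homog (i + 1)
                                 & val z = koszul_d w >].

Lemma koszul_boundary_closed i : subsemimod_closed (@koszul_boundary i).
Proof.
split; first split.
- by apply/asboolP; exists 0; rewrite ?rpred0 // !linear0.
- move=> u v /asboolP[f fi uf] /asboolP[g gi vg]; apply/asboolP.
  by exists (f + g); rewrite ?rpredD // !linearD /= uf vg.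
- move=> a u /asboolP[f fi uf]; apply/asboolP.
  by exists (a *: f); rewrite ?rpredZ // !linearZ /= uf.
Qed.

HB.instance Definition _ i := GRing.isSubmodClosed.Build R (koszul_cycles i)
  (@koszul_boundary i) (@koszul_boundary_closed i).

(* H_i (y; M), for every i in Z; it vanishes unless 0 <= i <= n.              *)
Definition koszul_homology (i : int) : lmodType R :=
  quotmod (GRing.SubmodClosed.clone R (koszul_cycles i) (@koszul_boundary i) _).

(* The sum over all i >= k stops at n, above which the homology vanishes.     *)
Definition euler_char (k : nat) : int :=
  \sum_(k <= i < n.+1) (-1) ^+ (i - k) * (mod_length (koszul_homology i%:Z))%:Z.

End Koszul.
End Modules.

Arguments colon0 [R] N x.
Arguments koszul_homology [R n] y M i.
Arguments euler_char [R n] y M k.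
Arguments system_of_parameters [R] m M [d] x.

(* Main.v *)
(* Let y' omit y_i.  The exact sequences                                      *)
(*   0 -> H_j(y') / y_i H_j(y') -> H_j(y) -> (0 : y_i)_{H_{j-1}(y')} -> 0     *)
(* give chi_k(y) = l((0 : y_i)_{H_{k-1}(y')})                                 *)
(*                 + \sum_(j >= k) (-1)^(j-k) e(y_i; H_j(y')),                *)
(* where e(u; N) = l(N / u N) - l((0 : u)_N) turns products into sums.  So as *)
(* a function of t = n_i alone, chi_k(x^n) = l((0 : x_i^t)_H) + c t, where H  *)
(* and c do not depend on t.  The submodules (0 : x_i^t)_H increase with t    *)
(* and stabilize: if chi_k is polynomial, their length is an eventually       *)
(* constant polynomial in t >= n0, hence constant.  Conversely, if they are   *)
(* constant for t >= n0, then chi_k is affine in each n_i, hence polynomial.  *)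
(* All lengths are finite: every a in m acts nilpotently on M / (x) M, so by  *)
(* the determinant trick a power of a acts on M as an element of (x); hence a *)
(* acts nilpotently on H_j(x^n), which is noetherian.                         *)

Require Import Defs.
From HB Require Import structures.
From mathcomp Require Import all_boot all_order all_algebra.
From mathcomp Require Import boolp.
From mathcomp Require Import mpoly.
From mathcomp Require Import ring.

Set Implicit Arguments.
Unset Strict Implicit.
Unset Printing Implicit Defensive.

Import GRing.Theory.
Local Open Scope ring_scope.

(** * Chains and lengths *)

(** One exponent varies at a time. The Koszul complex on $y$ is the mapping cone of $y_i$ on the
    complex of $y'$, which omits $y_i$, so $H_j(y)$ is an extension of $(0:y_i)$ in $H_{j-1}(y')$ by
    $H_j(y')/y_iH_j(y')$ ([koszul_homology_length]). In the alternating sum these lengths telescope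
    to one colon length plus signed multiplicities ([euler_char_mult]), and a multiplicity at
    $x_i^t$ is linear in $t$ ([multM], [multX]). Hence, with $t=n_i$ and $N$ the homology in degree
    $k-1$ without the $i$-th variable, $\chi_k=\beta(t)+ct$, where $\beta(t)$ is the length of
    $(0:x_i^t)_N$.

    The theorem is thus about $\beta$, which is eventually constant because $N$ is noetherian
    ([colon0X_stable]). If $\chi_k$ is polynomial, then $\beta$ is polynomial for $t\ge n_0$, so
    constant there ([poly_eventually_const]), and nested submodules of equal finite length coincide
    ([colon0X_eq]). Conversely, constant colon submodules make $\chi_k$ affine in each exponent
    separately, and interpolation yields a polynomial ([multiaffine_polynomial]).

    All lengths must be finite ([koszul_homology_finite_length]): the determinant trick carries
    nilpotence of $\mathfrak m$ on $M/(x)M$ over to the Koszul homology, and a noetherian module on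
    which elements of $\mathfrak m$ act nilpotently has finite length ([finite_length_nilpotent]).
    Lengths are maximal lengths of chains of submodules, additive by the modular law
    ([max_chain_length_linear]). *)

Section Chains.
Variables (T : Type) (P : {pred T} -> Prop).
Implicit Types S : {pred T}.

(** Recording only the top member makes widening, concatenation and projection of chains plain
    inductions. *)
Inductive chain_to : {pred T} -> nat -> Prop :=
| chain_to0 S : P S -> chain_to S 0
| chain_toS S S' l : chain_to S l -> P S' ->
    {subset S <= S'} -> ~ {subset S' <= S} -> chain_to S' l.+1.

Lemma chain_toP S l : chain_to S l -> P S. Proof. by case. Qed.

Lemma chain_to_widen S S' l :
  chain_to S l -> P S' -> {subset S <= S'} -> chain_to S' l.
Proof.
case=> [S0 _ PS' _|S0 S1 k cS0 PS1 S01 nS10 PS' S1S']; first exact: chain_to0.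
apply: (chain_toS cS0 PS') => [v /S01/S1S'//|S'S0]; apply: nS10 => v /S1S'.
exact: S'S0.
Qed.

Lemma has_chainP l : has_chain P l <-> exists S, chain_to S l.
Proof.
split=> [[c [Pc cP]]|[S cS]].
  exists (c l); elim: l => [|l IHl] in Pc cP *; first exact: chain_to0 (Pc 0 _).
  have [//|sub nsub] := cP l; apply: (chain_toS _ _ sub nsub).
    by apply: IHl => i li; [apply: Pc (leqW li)|apply: cP (leqW li)].
  exact: Pc.
suff [c [_ [Pc cP]]] : exists c, c l = S /\ (forall i, (i <= l)%N -> P (c i)) /\
    (forall i, (i < l)%N -> {subset c i <= c i.+1} /\ ~ {subset c i.+1 <= c i}).
  by exists c.
elim: cS => {S l} [S PS|S S' l _ [c [cl [Pc cP]]] PS' SS' nS'S].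
  by exists (fun=> S).
exists (fun i => if (i <= l)%N then c i else S'); rewrite ltnn; split=> //.
split=> i; first by case: (leqP i l) => [/Pc|].

rewrite [(i < l.+1)%N]ltnS leq_eqVlt => /orP[/eqP->|il].
  by rewrite eqxx ltnn cl.
by rewrite il orbT; apply: cP.
Qed.

Lemma has_chain0 S : P S -> has_chain P 0.
Proof. by move=> PS; apply/has_chainP; exists S; exact: chain_to0. Qed.

Lemma max_chain_length_exists S b :
  P S -> (forall l, has_chain P l -> (l <= b)%N) ->
  exists l, max_chain_length P l.
Proof.
move=> PS le_b.
have ex0 : exists l, `[< has_chain P l >] by exists 0; apply/asboolP/(has_chain0 PS).
have le_b' l : `[< has_chain P l >] -> (l <= b)%N by move/asboolP/le_b.
case: (ex_maxnP ex0 le_b') => l /asboolP cl lmax.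
by exists l; split=> // l' /asboolP/lmax.
Qed.

Lemma max_chain_length_unique l l' :
  max_chain_length P l -> max_chain_length P l' -> l = l'.
Proof.
by move=> [cl ml] [cl' ml']; apply/eqP; rewrite eqn_leq ml' // ml.
Qed.

End Chains.

(** The bottom of the second chain takes the place of the top of the first, so no strict step is
    lost even if the two coincide. *)
Lemma chain_to_cat T (P Q : {pred T} -> Prop) S p S' q :
  chain_to P S p -> (forall S1, Q S1 -> P S1 /\ {subset S <= S1}) ->
  chain_to Q S' q -> chain_to P S' (p + q).
Proof.
move=> cS QP; elim=> {S' q} [S1 /QP[PS1 SS1]|S1 S2 q _ IH /QP[PS2 _] S12 nS21].
  by rewrite addn0; apply: chain_to_widen cS PS1 SS1.
by rewrite addnS; apply: chain_toS IH PS2 S12 nS21.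
Qed.

Lemma chain_to_image T T' (P : {pred T} -> Prop) (P' : {pred T'} -> Prop)
    (e : {pred T} -> {pred T'}) S l :
  (forall S, P S -> P' (e S)) ->
  (forall S S', P S -> P S' -> {subset S <= S'} -> {subset e S <= e S'}) ->
  (forall S S', P S -> P S' -> {subset e S <= e S'} -> {subset S <= S'}) ->
  chain_to P S l -> chain_to P' (e S) l.
Proof.
move=> Pe me re; elim=> {S l} [S PS|S S' l cS IH PS' SS' nS'S].
  exact/chain_to0/Pe.
have PS := chain_toP cS; apply: chain_toS IH (Pe _ PS') (me _ _ PS PS' SS') _.
by move/(re _ _ PS' PS).
Qed.

(* The modular law, abstractly: an interval P into which P1 and P2 embed, one *)
(* below the other, and whose inclusions are detected by P1 and P2 together.  *)
Section ChainAdditivity.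
Variables (T T1 T2 : Type) (P : {pred T} -> Prop).
Variables (P1 : {pred T1} -> Prop) (P2 : {pred T2} -> Prop).
Variables (e1 : {pred T1} -> {pred T}) (e2 : {pred T2} -> {pred T}).
Variables (p1 : {pred T} -> {pred T1}) (p2 : {pred T} -> {pred T2}).
Variables (bot1 : {pred T1}) (bot2 : {pred T2}).
Hypotheses (P1bot : P1 bot1) (P2bot : P2 bot2).
Hypothesis Pe1 : forall S, P1 S -> P (e1 S).
Hypothesis Pe2 : forall S, P2 S -> P (e2 S).
Hypothesis me1 :
  forall S S', P1 S -> P1 S' -> {subset S <= S'} -> {subset e1 S <= e1 S'}.
Hypothesis me2 :
  forall S S', P2 S -> P2 S' -> {subset S <= S'} -> {subset e2 S <= e2 S'}.
Hypothesis re1 :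
  forall S S', P1 S -> P1 S' -> {subset e1 S <= e1 S'} -> {subset S <= S'}.
Hypothesis re2 :
  forall S S', P2 S -> P2 S' -> {subset e2 S <= e2 S'} -> {subset S <= S'}.
Hypothesis e1e2 : forall S S', P1 S -> P2 S' -> {subset e1 S <= e2 S'}.
Hypothesis Pp1 : forall S, P S -> P1 (p1 S).
Hypothesis Pp2 : forall S, P S -> P2 (p2 S).
Hypothesis mp1 :
  forall S S', P S -> P S' -> {subset S <= S'} -> {subset p1 S <= p1 S'}.
Hypothesis mp2 :
  forall S S', P S -> P S' -> {subset S <= S'} -> {subset p2 S <= p2 S'}.
Hypothesis rp : forall S S', P S -> P S' -> {subset S <= S'} ->
  {subset p1 S' <= p1 S} -> {subset p2 S' <= p2 S} -> {subset S' <= S}.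

Lemma has_chain_add a b : has_chain P1 a -> has_chain P2 b -> has_chain P (a + b).
Proof.
move=> /has_chainP[S cS] /has_chainP[S' cS']; apply/has_chainP; exists (e2 S').
pose Q S1 := exists2 S0, P2 S0 & S1 = e2 S0.
apply: (@chain_to_cat _ _ Q (e1 S)).
- exact: chain_to_image Pe1 me1 re1 cS.
- by move=> _ [S0 PS0 ->]; split; [apply: Pe2|apply: e1e2 (chain_toP cS) PS0].
- by apply: (chain_to_image (P := P2)) me2 re2 cS' => S0 PS0; exists S0.
Qed.

Lemma has_chain_split l : has_chain P l ->
  exists a b, [/\ has_chain P1 a, has_chain P2 b & l = (a + b)%N].
Proof.
move=> /has_chainP[S cS].
suff [a [b [ca cb ->]]] : exists a b,
    [/\ chain_to P1 (p1 S) a, chain_to P2 (p2 S) b & l = (a + b)%N].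
  by exists a, b; split=> //; apply/has_chainP; [exists (p1 S)|exists (p2 S)].
elim: cS => {S l} [S PS|S S' l cS [a [b [ca cb ->]]] PS' SS' nS'S].
  by exists 0, 0; split=> //; apply: chain_to0; [apply: Pp1|apply: Pp2].
have PS := chain_toP cS; have m1 := mp1 PS PS' SS'; have m2 := mp2 PS PS' SS'.
(* Each strict step is charged to the first projection if that one grows; otherwise [rp] forces the
   second one to grow. *)
have [/(rp PS PS' SS') sub1|nsub1] := pselect {subset p1 S' <= p1 S}; last first.
  exists a.+1, b; split=> //; first exact: chain_toS ca (Pp1 PS') m1 nsub1.
  exact: chain_to_widen cb (Pp2 PS') m2.
exists a, b.+1; split; rewrite ?addnS //; first exact: chain_to_widen ca (Pp1 PS') m1.
by apply: chain_toS cb (Pp2 PS') m2 _ => /sub1.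
Qed.

Lemma max_chain_length_add a b :
  max_chain_length P1 a -> max_chain_length P2 b -> max_chain_length P (a + b).
Proof.
move=> [ca ma] [cb mb]; split; first exact: has_chain_add.
by move=> _ /has_chain_split[a' [b' [/ma a'a /mb b'b ->]]]; apply: leq_add.
Qed.

(** Joining a chain of one factor with a one-member chain of the other gives a chain of [P], so [l]
    bounds both factors. *)
Lemma max_chain_length_split l : max_chain_length P l ->
  exists a b, max_chain_length P1 a /\ max_chain_length P2 b.
Proof.
move=> [_ ml].
have [a la] : exists a, max_chain_length P1 a.
  apply: (@max_chain_length_exists _ _ bot1 l) => // a ca.
  apply: leq_trans (leq_addr 0 a) _; apply/ml/has_chain_add => //.
  exact: has_chain0 P2bot.
have [b lb] : exists b, max_chain_length P2 b.
  apply: (@max_chain_length_exists _ _ bot2 l) => // b cb.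
  by apply/ml/(@has_chain_add 0 b) => //; exact: has_chain0 P1bot.
by exists a, b.
Qed.

End ChainAdditivity.

(** * Lengths of intervals of submodules, and their behaviour under linear maps *)

Section Submodules.
Variables (R : comNzRingType) (V : lmodType R).
Implicit Types S A B : {pred V}.

Lemma submod_closed0 S : submod_closed S -> 0 \in S. Proof. by case. Qed.

Lemma submod_closedZ S a v : submod_closed S -> v \in S -> a *: v \in S.
Proof. by move=> [S0 SP] vS; rewrite -[_ *: _]addr0 SP. Qed.

Lemma submod_closedDr S u v :
  submod_closed S -> u \in S -> v \in S -> u + v \in S.
Proof. by move=> [S0 SP] uS vS; rewrite -[u]scale1r SP. Qed.

Lemma submod_closedN S u : submod_closed S -> u \in S -> - u \in S.
Proof. by move=> ? ?; rewrite -scaleN1r submod_closedZ. Qed.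

Lemma submod_closedBr S u v :
  submod_closed S -> u \in S -> v \in S -> u - v \in S.
Proof. by move=> ? ? ?; rewrite submod_closedDr // submod_closedN. Qed.

Lemma submod_closed_sum S I r (P : pred I) (F : I -> V) : submod_closed S ->
  (forall i, P i -> F i \in S) -> \sum_(i <- r | P i) F i \in S.
Proof.
move=> Sm FS; elim/big_ind: _ => // [|u v]; first exact: submod_closed0.
exact: submod_closedDr.
Qed.

Definition submod_add A B : {pred V} :=
  [pred v | `[< exists2 a, a \in A & exists2 b, b \in B & v = a + b >]].

Lemma submod_closed_add A B :
  submod_closed A -> submod_closed B -> submod_closed (submod_add A B).
Proof.
move=> Am Bm; split=> [|r u v /asboolP[a aA [b bB ->]] /asboolP[a' a'A [b' b'B ->]]].
  apply/asboolP; exists 0; first exact: submod_closed0.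
  by exists 0; rewrite ?addr0 //; exact: submod_closed0.
apply/asboolP; exists (r *: a + a'); first by case: Am => _; apply.
by exists (r *: b + b'); [case: Bm => _; apply|rewrite scalerDr addrACA].
Qed.

Lemma sub_submod_add A B : submod_closed B -> {subset A <= submod_add A B}.
Proof.
move=> Bm v vA; apply/asboolP; exists v => //.
by exists 0; rewrite ?addr0 //; exact: submod_closed0.
Qed.

Definition cyclic_submod w : {pred V} := [pred v | `[< exists a, v = a *: w >]].

Lemma submod_closed_cyclic w : submod_closed (cyclic_submod w).
Proof.
split; first by apply/asboolP; exists 0; rewrite scale0r.
move=> r _ _ /asboolP[a ->] /asboolP[b ->]; apply/asboolP.
by exists (r * a + b); rewrite scalerDl scalerA.
Qed.

Lemma submod_closedI A B :
  submod_closed A -> submod_closed B -> submod_closed [predI A & B].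
Proof.
move=> Am Bm; split=> [|r u v /andP[uA uB] /andP[vA vB]].
  by rewrite inE !submod_closed0.
by apply/andP; split; [case: Am|case: Bm] => _; apply.
Qed.

Lemma submod_closed_pred1 : submod_closed (pred1 (0 : V)).
Proof.
split=> [|r u v /eqP-> /eqP->]; first by rewrite inE.
by rewrite inE scaler0 addr0.
Qed.

Lemma submod_closed_predT : submod_closed (predT : {pred V}).
Proof. by split. Qed.

Lemma pred_ext S S' : S =i S' -> S = S'.
Proof. by move=> SS'; apply/funext => v; apply: SS'. Qed.

Definition interval A B : {pred V} -> Prop :=
  fun S => [/\ submod_closed S, {subset A <= S} & {subset S <= B}].

Definition finite_colength A B := exists l, max_chain_length (interval A B) l.

(** For submodules [A] inside [B] this is the length of $B/A$, read off the lattice without forming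
    the quotient; 0 by default when infinite. *)
Definition colength A B : nat :=
  if pselect (finite_colength A B) is left h then sval (cid h) else 0%N.

Lemma colength_eq A B l : max_chain_length (interval A B) l -> colength A B = l.
Proof.
move=> ml; rewrite /colength; case: pselect => [h|]; last by case; exists l.
exact: max_chain_length_unique (svalP (cid h)) ml.
Qed.

Lemma colengthP A B :
  finite_colength A B -> max_chain_length (interval A B) (colength A B).
Proof. by move=> [l ml]; rewrite (colength_eq ml). Qed.

Lemma max_chain_length_refl A : submod_closed A -> max_chain_length (interval A A) 0.
Proof.
move=> Am; split; first by apply: (@has_chain0 _ _ A); split.
move=> [//|l] [c [Pc cP]]; have [_ []] := cP 0 isT.
have [_ Ac _] := Pc 0 isT; have [_ _ cA] := Pc 1 isT.
by move=> v /cA/Ac.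
Qed.

Lemma colength_refl A : submod_closed A -> colength A A = 0.
Proof. by move/max_chain_length_refl/colength_eq. Qed.

Lemma colength_eq0 A B : submod_closed A -> submod_closed B -> {subset A <= B} ->
  finite_colength A B -> colength A B = 0%N -> {subset B <= A}.
Proof.
move=> Am Bm AB /colengthP[_ ml] l0; apply: contrapT => nBA.
have /ml : has_chain (interval A B) 1; last by rewrite l0.
by exists (fun i => if i == 0 then A else B); split=> [[|i] _|[|i]//]; split.
Qed.

Lemma interval_full :
  interval (pred1 0) predT = (fun S => submod_closed S) :> ({pred V} -> Prop).
Proof.
apply/funext => S; apply/propext; split=> [[]//|Sm].
by split=> // v /eqP->; exact: submod_closed0.
Qed.

Lemma mod_length_colength : mod_length V = colength (pred1 0) predT.
Proof.
by rewrite /mod_length /colength /finite_length /finite_colength interval_full.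
Qed.

Lemma finite_length_colength :
  finite_length V <-> finite_colength (pred1 (0 : V)) predT.
Proof. by rewrite /finite_length /finite_colength interval_full. Qed.

End Submodules.

Section LinearMaps.
Variables (R : comNzRingType) (V W : lmodType R) (f : {linear V -> W}).
Implicit Types (A B S : {pred V}) (T : {pred W}).

Definition lin_image A : {pred W} := [pred w | `[< exists2 v, v \in A & w = f v >]].
Definition lin_preim T : {pred V} := [pred v | f v \in T].
Definition lin_ker : {pred V} := [pred v | f v == 0].

Lemma mem_lin_image A v : v \in A -> f v \in lin_image A.
Proof. by move=> vA; apply/asboolP; exists v. Qed.

Lemma submod_closed_image A : submod_closed A -> submod_closed (lin_image A).
Proof.
move=> Am; split=> [|r _ _ /asboolP[u uA ->] /asboolP[v vA ->]].
  by rewrite -(linear0 f) mem_lin_image // submod_closed0.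
by rewrite -linearP mem_lin_image //; case: Am => _; apply.
Qed.

Lemma submod_closed_preim T : submod_closed T -> submod_closed (lin_preim T).
Proof.
move=> [T0 TP]; split=> [|r u v uT vT]; first by rewrite inE linear0.
by rewrite inE linearP TP.
Qed.

Lemma submod_closed_ker : submod_closed lin_ker.
Proof.
split=> [|r u v /eqP fu /eqP fv]; first by rewrite inE linear0.
by rewrite inE linearP fu fv scaler0 addr0.
Qed.

Section Interval.
Variables A B : {pred V}.
Hypotheses (Am : submod_closed A) (Bm : submod_closed B) (AB : {subset A <= B}).

Let P1 := interval [predI A & lin_ker] [predI B & lin_ker].
Let P2 := interval (lin_image A) (lin_image B).
Let e1 S := submod_add A S.
Let e2 T : {pred V} := [predI lin_preim T & B].
Let p1 S : {pred V} := [predI S & lin_ker].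
Let p2 S := lin_image S.


(** The two embedded intervals meet at $A+(B\cap\ker f)$. An inclusion of $S$ in $S'$ is an equality
    once both have the same image and the same intersection with the kernel: correct an element of
    $S'$ by one of $S$ with the same image. *)
Lemma max_chain_length_linear :
  (forall a b, max_chain_length P1 a -> max_chain_length P2 b ->
    max_chain_length (interval A B) (a + b)) /\
  (forall l, max_chain_length (interval A B) l ->
    exists a b, max_chain_length P1 a /\ max_chain_length P2 b).
Proof.
have Km := submod_closed_ker.
have ABi : {subset lin_image A <= lin_image B}.
  by move=> _ /asboolP[v vA ->]; rewrite mem_lin_image // AB.
have P1b : P1 [predI A & lin_ker].
  split=> //; first exact: submod_closedI.
  by move=> v /andP[vA vK]; rewrite inE /= AB.
have P2b : P2 (lin_image A) by split=> //; exact: submod_closed_image.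
have Pe1 S : P1 S -> interval A B (e1 S).
  move=> [Sm AS SB]; split; first exact: submod_closed_add.
    exact: sub_submod_add.
  move=> _ /asboolP[a aA [b /SB/andP[bB _] ->]].
  by rewrite submod_closedDr // AB.
have Pe2 T : P2 T -> interval A B (e2 T).
  move=> [Tm AT TB]; split.
  - by apply: submod_closedI => //; apply: submod_closed_preim.
  - by move=> v vA; apply/andP; split; [apply/AT/mem_lin_image|apply: AB].
  - by move=> v /andP[].
have me1 S S' : P1 S -> P1 S' -> {subset S <= S'} -> {subset e1 S <= e1 S'}.
  move=> _ _ SS' _ /asboolP[a aA [b /SS' bS' ->]]; apply/asboolP.
  by exists a => //; exists b.
have me2 T T' : P2 T -> P2 T' -> {subset T <= T'} -> {subset e2 T <= e2 T'}.
  by move=> _ _ TT' v /andP[vT vB]; apply/andP; split=> //; exact: TT'.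
have re1 S S' : P1 S -> P1 S' -> {subset e1 S <= e1 S'} -> {subset S <= S'}.
  move=> [Sm AS SB] [S'm AS' S'B] sub v vS.
  have /sub/asboolP[a aA [b bS' vE]] : v \in e1 S.
    apply/asboolP; exists 0; first exact: submod_closed0.
    by exists v; rewrite ?add0r.
  rewrite vE submod_closedDr // AS' // inE /= aA /=.
  have /SB/andP[_ vK] := vS; have /S'B/andP[_ bK] := bS'.
  by rewrite -[a](addrK b) -vE submod_closedBr.
have re2 T T' : P2 T -> P2 T' -> {subset e2 T <= e2 T'} -> {subset T <= T'}.
  move=> [Tm AT TB] [T'm AT' T'B] sub w /[dup] wT /TB/asboolP[v vB wE].
  have /sub/andP[] : v \in e2 T by rewrite inE /= vB andbT inE -wE.
  by rewrite !inE -wE.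
have e12 S T : P1 S -> P2 T -> {subset e1 S <= e2 T}.
  move=> [Sm AS SB] [Tm AT TB] _ /asboolP[a aA [b /SB/andP[bB /eqP fb] ->]].
  apply/andP; split; last exact: submod_closedDr (AB aA) bB.
  by rewrite inE linearD /= fb addr0; apply/AT/mem_lin_image.
have Pp1 S : interval A B S -> P1 (p1 S).
  move=> [Sm AS SB]; split; first exact: submod_closedI.
    by move=> v /andP[/AS vS vK]; apply/andP.
  by move=> v /andP[/SB vS vK]; apply/andP.
have Pp2 S : interval A B S -> P2 (p2 S).
  move=> [Sm AS SB]; split; first exact: submod_closed_image.
    by move=> _ /asboolP[v /AS vS ->]; rewrite mem_lin_image.
  by move=> _ /asboolP[v /SB vS ->]; rewrite mem_lin_image.
have mp1 S S' : interval A B S -> interval A B S' ->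
    {subset S <= S'} -> {subset p1 S <= p1 S'}.
  by move=> _ _ SS' v /andP[/SS' vS vK]; apply/andP.
have mp2 S S' : interval A B S -> interval A B S' ->
    {subset S <= S'} -> {subset p2 S <= p2 S'}.
  by move=> _ _ SS' _ /asboolP[v /SS' vS ->]; rewrite mem_lin_image.
have rp S S' : interval A B S -> interval A B S' -> {subset S <= S'} ->
    {subset p1 S' <= p1 S} -> {subset p2 S' <= p2 S} -> {subset S' <= S}.
  move=> [Sm _ _] [S'm _ _] SS' sub1 sub2 v vS'.
  have /sub2/asboolP[u uS fvu] : f v \in p2 S' by rewrite mem_lin_image.
  have /sub1/andP[vuS _] : v - u \in p1 S'.
    by rewrite inE /= submod_closedBr // ?SS' // inE linearB /= fvu subrr.
  by rewrite -(subrK u v) submod_closedDr.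
split.
  exact: (max_chain_length_add Pe1 Pe2 me1 me2 re1 re2 e12 Pp1 Pp2 mp1 mp2 rp).
exact: (max_chain_length_split P1b P2b Pe1 Pe2 me1 me2 re1 re2 e12).
Qed.

Lemma finite_colength_linear : finite_colength A B <->
  finite_colength [predI A & lin_ker] [predI B & lin_ker] /\
  finite_colength (lin_image A) (lin_image B).
Proof.
have [add split_l] := max_chain_length_linear; split=> [[l /split_l[a [b [la lb]]]]|].
  by split; [exists a|exists b].
by move=> [[a la] [b lb]]; exists (a + b)%N; apply: add.
Qed.

Lemma colength_linear : finite_colength A B ->
  colength A B = (colength [predI A & lin_ker] [predI B & lin_ker] +
                  colength (lin_image A) (lin_image B))%N.
Proof.
move=> fAB; have [/colengthP fk /colengthP fi] := finite_colength_linear.1 fAB.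
by have [add _] := max_chain_length_linear; apply/colength_eq/add.
Qed.

End Interval.
End LinearMaps.

Section QuotientMap.
Variables (R : comNzRingType) (V : lmodType R) (I : submodClosed V).
Local Open Scope quotient_scope.

Definition quotmod_pi (v : V) : quotmod I := \pi_(quotmod I) v.

Lemma quotmod_pi_is_linear : linear quotmod_pi.
Proof.
by move=> a u v; rewrite /quotmod_pi -quotmod_piD -(quotmod_piZ I).
Qed.

HB.instance Definition _ :=
  GRing.isLinear.Build R V (quotmod I) *:%R quotmod_pi quotmod_pi_is_linear.

Lemma quotmod_pi_eq0 v : (quotmod_pi v == 0) = (v \in I).
Proof.
rewrite -(linear0 quotmod_pi) -[v in RHS]subr0.
by apply/eqP/idP => [/quotmod_eqP|vI]; last exact/quotmod_eqP.
Qed.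

Lemma quotmod_pi_surj u : exists v, u = quotmod_pi v.
Proof. by exists (repr u); rewrite /quotmod_pi reprK. Qed.

End QuotientMap.

Section Transport.
Variables (R : comNzRingType) (V W : lmodType R) (f : {linear V -> W}).
Implicit Types (A B : {pred V}) (T : {pred W}).

(** The last hypothesis makes [A] and [B] meet the kernel in the same submodule, so the kernel
    contributes length zero. *)
Lemma colength_image A B : submod_closed A -> submod_closed B ->
  {subset A <= B} -> {subset [predI B & lin_ker f] <= A} ->
  (finite_colength A B <-> finite_colength (lin_image f A) (lin_image f B)) /\
  colength A B = colength (lin_image f A) (lin_image f B).
Proof.
move=> Am Bm AB kA.
have E : [predI A & lin_ker f] = [predI B & lin_ker f] :> {pred V}.
  apply/pred_ext => v; apply/andP/andP => -[vA vk]; split=> //; first exact: AB.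
  by apply: kA; apply/andP.
have Km := submod_closedI Bm (submod_closed_ker f).
have F : finite_colength A B <-> finite_colength (lin_image f A) (lin_image f B).
  rewrite (finite_colength_linear f Am Bm AB) E; split=> [[]//|fi]; split=> //.
  by exists 0%N; apply: max_chain_length_refl.
split=> //; have [fAB|nfAB] := pselect (finite_colength A B).
  by rewrite (colength_linear f Am Bm AB fAB) E colength_refl.
(* Both colengths take the default value 0. *)
have nfi : ~ finite_colength (lin_image f A) (lin_image f B) by move/F.
by rewrite /colength; case: pselect => // ?; case: pselect.
Qed.

Lemma colength_preim T1 T2 : submod_closed T1 -> submod_closed T2 ->
  {subset T1 <= T2} -> (forall w, exists v, w = f v) ->
  (finite_colength (lin_preim f T1) (lin_preim f T2) <-> finite_colength T1 T2) /\
  colength (lin_preim f T1) (lin_preim f T2) = colength T1 T2.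
Proof.
move=> T1m T2m T12 fsurj.
have E T : lin_image f (lin_preim f T) = T.
  apply/pred_ext => w; apply/asboolP/idP => [[v vT ->]//|].
  by have [v ->] := fsurj w; exists v.
rewrite -{2 4}(E T1) -{2 4}(E T2); apply: colength_image.
- exact: submod_closed_preim.
- exact: submod_closed_preim.
- by move=> v; apply: T12.
- by move=> v /andP[_ /eqP fv0]; rewrite inE fv0 submod_closed0.
Qed.

End Transport.

Section ThreeTerms.
Variables (R : comNzRingType) (V : lmodType R).
Variables A B C : {pred V}.
Hypotheses (Am : submod_closed A) (Bm : submod_closed B) (Cm : submod_closed C).
Hypotheses (AB : {subset A <= B}) (BC : {subset B <= C}).

Let I : submodClosed V :=
  HB.pack B (GRing.isSubmodClosed.Build R V B (GRing.submod_closed_semi Bm)).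
Let f : {linear V -> quotmod I} := quotmod_pi I.

Let f0 v : (f v == 0) = (v \in B). Proof. exact: quotmod_pi_eq0. Qed.

Let AC : {subset A <= C}. Proof. by move=> v /AB/BC. Qed.

Let EA : [predI A & lin_ker f] = A :> {pred V}.
Proof.
apply/pred_ext => v; apply/andP/idP => [[]//|vA].
by split=> //; rewrite inE f0 AB.
Qed.

Let EC : [predI C & lin_ker f] = B :> {pred V}.
Proof.
apply/pred_ext => v; apply/andP/idP => [[_]|vB]; first by rewrite inE f0.
by split; [apply: BC|rewrite inE f0].
Qed.

Let Ef : lin_image f A = lin_image f B.
Proof.
have E0 S : submod_closed S -> {subset S <= B} -> lin_image f S = pred1 0.
  move=> Sm SB; apply/pred_ext => w; apply/asboolP/idP => [[v /SB vB ->]|/eqP->].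
    by rewrite inE f0.
  by exists 0; rewrite ?submod_closed0 ?linear0.
by rewrite !E0.
Qed.

Let transportBC := colength_image (f := f) Bm Cm BC.

(** Apply the kernel-image decomposition to $V\to V/B$: the kernel part of the interval from [A] to
    [C] is the one from [A] to [B], and the image part is that of [B] and [C]. *)
Lemma finite_colengthD :
  finite_colength A C <-> finite_colength A B /\ finite_colength B C.
Proof.
rewrite (finite_colength_linear f Am Cm AC) EA EC Ef.
by have [|<- _] := transportBC; first by move=> v /andP[_]; rewrite inE f0.
Qed.

Lemma colengthD : finite_colength A C ->
  colength A C = (colength A B + colength B C)%N.
Proof.
move=> fAC; rewrite (colength_linear f Am Cm AC fAC) EA EC Ef.
by have [|_ ->] := transportBC; first by move=> v /andP[_]; rewrite inE f0.
Qed.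

End ThreeTerms.

(** * The multiplicity of a ring element on a module *)

Section Multiplicity.
Variables (R : comNzRingType) (N : lmodType R).
Implicit Types (u v x : R).

Definition scale_image x : {pred N} := lin_image (GRing.scale x : {linear N -> N}) predT.

Definition finite_mult x := finite_colength (scale_image x) predT /\
  finite_colength (pred1 (0%R : N)) (colon0 N x).

(** The Euler characteristic of the two-term complex $N\to N$ given by [x]. *)
Definition mult x : int :=
  (colength (scale_image x) predT)%:Z - (colength (pred1 (0%R : N)) (colon0 N x))%:Z.

Lemma mem_scale_image x w : (w \in scale_image x) <-> exists z, w = x *: z.
Proof. by split=> [/asboolP[z _ ->]|[z ->]]; [exists z|apply/asboolP; exists z]. Qed.

Lemma mem_colon0 x w : (w \in colon0 N x) = (x *: w == 0). Proof. by []. Qed.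

Lemma submod_closed_scale_image x : submod_closed (scale_image x).
Proof. exact/submod_closed_image/submod_closed_predT. Qed.

Lemma submod_closed_colon0 x : submod_closed (colon0 N x).
Proof. exact: (submod_closed_ker (GRing.scale x : {linear N -> N})). Qed.

Lemma scale_imageM u v :
  lin_image (GRing.scale u : {linear N -> N}) (scale_image v) = scale_image (u * v).
Proof.
apply/pred_ext => w; apply/asboolP/idP => [[_ /mem_scale_image[z ->] ->]|].
  by apply/mem_scale_image; exists z; rewrite /= scalerA.
move/mem_scale_image=> [z ->]; exists (v *: z); last by rewrite /= scalerA.
by apply/mem_scale_image; exists z.
Qed.

(** Multiplication by $u$ maps $(0:uv)$ onto $uN\cap(0:v)$ with kernel $(0:u)$. *)
Lemma colength_colon0M u v : finite_colength (pred1 (0%R : N)) (colon0 N (u * v)) ->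
  colength (pred1 (0%R : N)) (colon0 N (u * v)) = (colength (pred1 (0%R : N)) (colon0 N u) +
    colength (pred1 (0%R : N)) [predI scale_image u & colon0 N v])%N.
Proof.
have c0 x w : (w \in colon0 N x) = (x *: w == 0) by [].
move=> f0; have sub0 x : {subset pred1 (0%R : N) <= colon0 N x}.
  by move=> w /eqP->; rewrite c0 scaler0.
have uvm := submod_closed_colon0 (u * v).
rewrite (colength_linear (GRing.scale u : {linear N -> N}) _ uvm (@sub0 _) f0);
  last exact: submod_closed_pred1.
congr addn; congr colength; apply/pred_ext => w.
- apply/andP/eqP => [[/eqP//]|->].
  by split; rewrite !inE //= scaler0.
- apply/andP/idP => [[_ ]//|wu]; split=> //.
  by rewrite c0 mulrC -scalerA (eqP wu) scaler0.
- apply/asboolP/eqP => [[_ /eqP-> ->]|->]; first by rewrite /= scaler0.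
  by exists 0; rewrite ?inE //= scaler0.
- apply/asboolP/andP => [[z + ->]|[/mem_scale_image[z ->] +]].
    rewrite c0 mulrC -scalerA => zuv; split=> //.
    by apply/mem_scale_image; exists z.
  by rewrite c0 scalerA => zuv; exists z; rewrite ?c0 1?mulrC.
Qed.

(* Comparing the two factorizations of multiplication by u v on (0 : u v)     *)
(* and on N / u v N makes all the correction terms cancel.                    *)
Lemma multM u v : finite_mult u -> finite_mult v -> finite_mult (u * v) ->
  mult (u * v) = mult u + mult v.
Proof.
move=> [fiu fku] [fiv fkv] [fiuv fkuv].
have pm := submod_closed_predT N.
have Evu : colength (pred1 (0%R : N)) (colon0 N (u * v)) = (colength (pred1 (0%R : N)) (colon0 N v) +
    colength (pred1 (0%R : N)) [predI scale_image v & colon0 N u])%N.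
  by rewrite mulrC colength_colon0M // mulrC.
have km := submod_closed_colon0 u.
have Im := submod_closedI (submod_closed_scale_image v) km.
have m0 := submod_closed_pred1 N.
have E1 : colength (pred1 (0%R : N)) (colon0 N u) =
    (colength (pred1 (0%R : N)) [predI scale_image v & colon0 N u] +
     colength [predI scale_image v & colon0 N u] (colon0 N u))%N.
  apply: colengthD => //; last by move=> w /andP[].
  by move=> w /eqP->; apply: submod_closed0 Im.
have ivm := submod_closed_scale_image v.
have E2 : colength (scale_image v) predT =
    (colength [predI scale_image v & colon0 N u] (colon0 N u) +
     colength (scale_image (u * v)) (scale_image u))%N.
  rewrite (colength_linear (GRing.scale u : {linear N -> N}) ivm pm _ fiv) //.
  rewrite scale_imageM; congr addn; congr colength.
have E3 : colength (scale_image (u * v)) predT =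
    (colength (scale_image (u * v)) (scale_image u) +
     colength (scale_image u) predT)%N.
  apply: colengthD => //; do ?exact: submod_closed_scale_image.
  move=> _ /mem_scale_image[z ->]; apply/mem_scale_image; exists (v *: z).
  by rewrite scalerA.
by rewrite /mult E3 E2 Evu E1 !PoszD; ring.
Qed.

Lemma multX x t : (forall s, finite_mult (x ^+ s)) -> mult (x ^+ t) = t%:Z * mult x.
Proof.
move=> fx; elim: t => [|t IHt].
  (* Since $1=1\cdot 1$, the multiplicity of 1 equals its double, so it is zero. *)
  have /(multM (fx 0)) := fx 0; rewrite mulr1 => /(_ (fx 0)) m2.
  by rewrite mul0r; apply: (addrI (mult (x ^+ 0))); rewrite addr0 -m2.
rewrite exprS multM -?exprS ?IHt //; last exact: fx 1.
by rewrite -addn1 PoszD mulrDl mul1r addrC.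
Qed.

End Multiplicity.
Arguments scale_image [R] N x.

(** * Noetherian modules and finite length *)

Section AscendingChains.
Variable R : comNzRingType.

Definition acc (V : lmodType R) := forall S : nat -> {pred V},
  (forall i, submod_closed (S i)) -> (forall i, {subset S i <= S i.+1}) ->
  exists t, forall i, (t <= i)%N -> {subset S i <= S t}.

Lemma chain_le (V : lmodType R) (S : nat -> {pred V}) i j :
  (forall i, {subset S i <= S i.+1}) -> (i <= j)%N -> {subset S i <= S j}.
Proof.
move=> SS /subnK<-; elim: (j - i)%N => [//|k IH] v /IH.
exact: SS.
Qed.

Lemma noetherian_acc : noetherian R -> acc R^o.
Proof.
move=> noeR S Sm SS.
pose U : {pred R^o} := [pred v | `[< exists i, v \in S i >]].
have Um : submod_closed U.
  split=> [|a u v /asboolP[i ui] /asboolP[j vj]].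
    by apply/asboolP; exists 0; apply: submod_closed0.
  apply/asboolP; exists (maxn i j); case: (Sm (maxn i j)) => _; apply.
    exact: chain_le SS (leq_maxl i j) _ ui.
  exact: chain_le SS (leq_maxr i j) _ vj.
have [r [g gP]] := noeR U Um.
have /choice[n nP] k : exists i, g k \in S i.
  suff /asboolP : g k \in U by [].
  apply/gP; exists (fun l => (l == k)%:R).
  rewrite (bigD1 k) //= eqxx scale1r big1 ?addr0 // => l /negPf->.
  by rewrite scale0r.
exists (\max_k n k) => i _ v vi.
have /gP[a ->] : v \in U by apply/asboolP; exists i.
apply: submod_closed_sum => // k _; apply: submod_closedZ => //.
exact: chain_le SS (leq_bigmax k) _ (nP k).
Qed.

Lemma acc_inj (V W : lmodType R) (f : {linear V -> W}) :
  injective f -> acc W -> acc V.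
Proof.
move=> fI accW S Sm SS.
have [i|i|t tP] := accW (fun i => lin_image f (S i)).
- exact: submod_closed_image.
- by move=> _ /asboolP[v /SS vS ->]; apply: mem_lin_image.
exists t => i ti v vi.
have /asboolP[u uS /fI->//] : f v \in lin_image f (S t).
exact: tP ti _ (mem_lin_image f vi).
Qed.

Lemma acc_surj (V W : lmodType R) (f : {linear V -> W}) :
  (forall w, exists v, w = f v) -> acc V -> acc W.
Proof.
move=> fs accV S Sm SS.
have [i|i v|t tP] := accV (fun i => lin_preim f (S i)).
- exact: submod_closed_preim.
- exact: SS.
by exists t => i ti w; have [v ->] := fs w; exact: tP ti v.
Qed.

(** Generators are stripped one at a time: on the span of [k :: s] a chain is controlled by its
    trace on the span of [s] and by the ideals [J i] of possible coefficients of [g k]. *)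
Lemma acc_span (V : lmodType R) (I : finType) (g : I -> V) :
  (forall v, exists a : I -> R, v = \sum_i a i *: g i) -> acc R^o -> acc V.
Proof.
move=> gV accR S Sm SS.
pose D s : {pred V} :=
  [pred v | `[< exists a : I -> R, v = \sum_(i <- s) a i *: g i >]].
have Dm s : submod_closed (D s).
  split=> [|r _ _ /asboolP[a ->] /asboolP[b ->]]; apply/asboolP.
    by exists (fun=> 0); rewrite big1 // => i _; rewrite scale0r.
  exists (fun i => r * a i + b i); rewrite scaler_sumr -big_split.
  by apply: eq_bigr => i _; rewrite scalerDl scalerA.
have SleS i j : (i <= j)%N -> {subset S i <= S j} by apply: chain_le.
suff [t tP] : exists t, forall i v, (t <= i)%N -> v \in S i ->
    v \in D (index_enum I) -> v \in S t.
  exists t => i ti v vi; apply: tP ti vi _; apply/asboolP.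
  by have [a ->] := gV v; exists a.
elim: (index_enum I) => [|k s [t1 t1P]].
  exists 0 => i v _ _ /asboolP[a ->]; rewrite big_nil.
  exact: submod_closed0.
pose J i : {pred R^o} :=
  [pred a | `[< exists2 v, v \in D s & (a : R) *: g k + v \in S i >]].
have [i|i a|t2 t2P] := accR J.
- split=> [|r a b /asboolP[u uD uS] /asboolP[v vD vS]]; apply/asboolP.
    by exists 0; rewrite ?scale0r ?addr0; exact: submod_closed0.
  exists (r *: u + v); first by case: (Dm s) => _; apply.
  have -> : (r *: a + b) *: g k + (r *: u + v) =
      r *: (a *: g k + u) + (b *: g k + v).
    by rewrite scalerDl -scalerA addrACA scalerDr.
  by case: (Sm i) => _; apply.
- by move=> /asboolP[v vD /SS vS]; apply/asboolP; exists v.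
exists (maxn t1 t2) => i v; rewrite geq_max => /andP[t1i t2i] vS /asboolP[a va].
rewrite big_cons in va; set v' := \sum_(j <- s) _ in va.
have v'D : v' \in D s by apply/asboolP; exists a.
(* Some element of [S t2] has the same coefficient [a k] on [g k] as [v]; the difference lies in the
   span of [s], where [t1] applies. *)
have /(t2P i t2i)/asboolP[v'' v''D v''S] : a k \in J i.
  by apply/asboolP; exists v' => //; rewrite -va.
have vE : v = (v' - v'') + (a k *: g k + v'').
  by rewrite va addrC addrA addrAC subrK addrC.
rewrite vE; apply: submod_closedDr => //; last exact: SleS (leq_maxr _ _) _ v''S.
apply: (SleS _ _ (leq_maxl _ _)); apply: t1P t1i _ (submod_closedBr (Dm s) v'D v''D).
rewrite -[v' - v''](addrK (a k *: g k + v'')) -vE submod_closedBr //.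
exact: SleS t2i _ v''S.
Qed.

Lemma acc_max (V : lmodType R) (P : {pred V} -> Prop) S0 : acc V ->
  P S0 -> (forall S, P S -> submod_closed S) ->
  exists S, P S /\ forall T, P T -> {subset S <= T} -> {subset T <= S}.
Proof.
move=> accV PS0 Pm; apply: contrapT => noMax.
have step (S : {S | P S}) :
    exists T : {S | P S}, {subset sval S <= sval T} /\ ~ {subset sval T <= sval S}.
  case: S => S PS; apply: contrapT => noT; apply: noMax; exists S; split=> // T PT ST.
  by apply: contrapT => nTS; apply: noT; exists (exist _ T PT).
have [f fP] := choice step.
pose c i := sval (iter i f (exist _ S0 PS0)).
have [i|i v|t /(_ t.+1 (leqnSn t))] := accV c.
- exact: Pm (svalP _).
- by have [] := fP (iter i f (exist _ S0 PS0)) => + _; apply.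
by have [_] := fP (iter t f (exist _ S0 PS0)).
Qed.

End AscendingChains.

Section ColonPowers.
Variables (R : comNzRingType) (N : lmodType R) (u : R).

Lemma sub_colon0X s t :
  (s <= t)%N -> {subset colon0 N (u ^+ s) <= colon0 N (u ^+ t)}.
Proof.
move=> st v; rewrite !mem_colon0 => /eqP sv.
by rewrite -(subnK st) exprD -scalerA sv scaler0.
Qed.

Lemma colon0X_stable : acc N ->
  exists t0, forall t, (t0 <= t)%N -> colon0 N (u ^+ t) = colon0 N (u ^+ t0).
Proof.
move=> accN; have [t|t|t0 t0P] := accN (fun t => colon0 N (u ^+ t)).
- exact: submod_closed_colon0.
- exact: sub_colon0X.
exists t0 => t t0t; apply/pred_ext => v.
by apply/idP/idP; [apply: t0P|apply: sub_colon0X].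
Qed.

Lemma colon0X_eq s t : (s <= t)%N ->
  finite_colength (pred1 0) (colon0 N (u ^+ t)) ->
  colength (pred1 0) (colon0 N (u ^+ t)) = colength (pred1 0) (colon0 N (u ^+ s)) ->
  colon0 N (u ^+ t) = colon0 N (u ^+ s).
Proof.
move=> st fin lenE.
have m0 := submod_closed_pred1 N; have cm r := submod_closed_colon0 N (u ^+ r).
have sub0 : {subset pred1 0 <= colon0 N (u ^+ s)}.
  by move=> v /eqP->; apply: submod_closed0.
have sub := sub_colon0X st.
have [_ fin'] := (finite_colengthD m0 (cm s) (cm t) sub0 sub).1 fin.
have /eqP := colengthD m0 (cm s) (cm t) sub0 sub fin.
rewrite lenE -[X in X == _]addn0 eqn_add2l => /eqP/esym len0.
apply/pred_ext => v; apply/idP/idP; last exact: sub.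
exact: colength_eq0 (cm s) (cm t) sub fin' len0 v.
Qed.

End ColonPowers.

Section FiniteLengthCriterion.
Variables (R : comNzRingType) (m : {pred R}).
Hypothesis m_max : maximal_ideal m.

Lemma maximal_ideal_submod : submod_closed (m : {pred R^o}).
Proof. by case: m_max => -[m0 _ mP] _; split. Qed.

(** Otherwise $\mathfrak m+(r)$ would not contain 1, so it would be a proper ideal above $\mathfrak
    m$ and $r$ would lie in $\mathfrak m$. *)
Lemma maximal_ideal_comax r : r \notin m -> exists2 u, u \in m & exists s, 1 = u + s * r.
Proof.
move=> rm; apply: contrapT => no1; case: m_max => -[m0 m1 mP] mmax.
pose J : {pred R} := [pred z | `[< exists2 u, u \in m & exists s, z = u + s * r >]].
have mJ : {subset m <= J}.
  by move=> u um; apply/asboolP; exists u => //; exists 0; rewrite mul0r addr0.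
have Ji : idealr_closed J.
  split; [exact: mJ|by apply/asboolP|].
  move=> a _ _ /asboolP[u um [s ->]] /asboolP[v vm [s' ->]]; apply/asboolP.
  exists (a * u + v); first exact: mP.
  by exists (a * s + s'); ring.
move: rm; rewrite (mmax J Ji mJ) //; apply/asboolP; exists 0 => //.
by exists 1; rewrite mul1r add0r.
Qed.

Variable V : lmodType R.

(** $(S+Rw)/S$ is a quotient of the field $R/\mathfrak m$. If [c 1] is strictly above [c 0], it
    contains some $s+aw$ with $a$ invertible modulo $\mathfrak m$, hence $w$, and is already
    everything. *)
Lemma finite_colength_simple (S : {pred V}) w : submod_closed S ->
  (forall a, a \in m -> a *: w \in S) ->
  finite_colength S (submod_add S (cyclic_submod w)).
Proof.
move=> Sm mw; set T := submod_add _ _.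
have Tm : submod_closed T := submod_closed_add Sm (submod_closed_cyclic w).
have ST : {subset S <= T} := sub_submod_add (submod_closed_cyclic w).
apply: (@max_chain_length_exists _ _ S 1); first by split.
case=> [|[|l]]// [c [Pc cP]]; exfalso.
have [c0m Sc0 _] := Pc 0 isT; have [c1m Sc1 c1T] := Pc 1 isT.
have [_ _ c2T] := Pc 2 isT; have [c01 nc10] := cP 0 isT; have [_ nc21] := cP 1 isT.
apply: nc10 => u uc1; apply: contrapT => uc0.
have /asboolP[s sS [_ /asboolP[a ->] uE]] := c1T _ uc1.
have am : a \notin m.
  by apply/negP => /mw aw; apply: uc0; rewrite uE submod_closedDr // Sc0.
have [b bm [q bq]] := maximal_ideal_comax am.
have wc1 : w \in c 1.
  rewrite -[w]scale1r bq scalerDl submod_closedDr //; first exact/Sc1/mw.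
  rewrite -scalerA submod_closedZ // -[a *: w](addKr s) -uE addrC.
  by rewrite submod_closedBr // Sc1.
apply: nc21 => v /c2T/asboolP[s' s'S [_ /asboolP[a' ->] ->]].
by rewrite submod_closedDr ?submod_closedZ // Sc1.
Qed.

(* If S is maximal among the submodules of finite length and v is not in S,   *)
(* some multiple w of v outside S satisfies m w <= S, and S + R w is longer.  *)
Lemma finite_length_nilpotent : noetherian R -> acc V ->
  (forall a (v : V), a \in m -> exists e, a ^+ e *: v = 0) -> finite_length V.
Proof.
move=> noeR accV nil; apply/finite_length_colength.
have m0 := submod_closed_pred1 V.
pose P (S : {pred V}) := submod_closed S /\ finite_colength (pred1 0) S.
have [||S [[Sm fS] Smax]] := acc_max (P := P) (S0 := pred1 0) accV.
- by split=> //; exists 0%N; apply: max_chain_length_refl.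
- by move=> S [].
have [VS|] := pselect (forall v, v \in S).
  by rewrite (_ : (predT : {pred V}) = S) //; apply/pred_ext => v; rewrite VS.
move=> /existsNP[v vS]; exfalso.
have [r [g gP]] := noeR _ maximal_ideal_submod.
have gm k : g k \in m.
  apply/gP; exists (fun l => (l == k)%:R).
  rewrite (bigD1 k) //= eqxx scale1r big1 ?addr0 // => l /negPf->.
  by rewrite scale0r.
have [w wS gw] : exists2 w, ~ w \in S & forall k, k \in enum 'I_r -> g k *: w \in S.
  elim: (enum _) => [|k s [w wS ws]]; first by exists v.
  have [e ew] := nil (g k) w (gm k).
  have ex0 : exists e, g k ^+ e *: w \in S.
    by exists e; rewrite ew; apply: submod_closed0.
  case: (ex_minnP ex0) => -[|f]; first by rewrite scale1r.
  move=> fS' fmin; exists (g k ^+ f *: w).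
    by move/fmin; rewrite ltnn.
  move=> l; rewrite inE => /orP[/eqP->|ls]; first by rewrite scalerA -exprS.
  by rewrite scalerA mulrC -scalerA submod_closedZ // ws.
have mw a : a \in m -> a *: w \in S.
  move=> /gP[b ->]; rewrite scaler_suml; apply: submod_closed_sum => // k _.
  by rewrite -scalerA submod_closedZ // gw // mem_enum.
have fT := finite_colength_simple Sm mw; set T := submod_add _ _ in fT.
have ST : {subset S <= T} := sub_submod_add (submod_closed_cyclic w).
have Tm : submod_closed T := submod_closed_add Sm (submod_closed_cyclic w).
apply: wS; apply: (Smax T) => //.
  split=> //; apply/(finite_colengthD m0 Sm Tm _ ST) => //.
  by move=> u /eqP->; apply: submod_closed0.
apply/asboolP; exists 0; first exact: submod_closed0.
by exists w; rewrite ?add0r //; apply/asboolP; exists 1; rewrite scale1r.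
Qed.

End FiniteLengthCriterion.

(** * Koszul homology *)

(* Splitting off the i-th variable: K(y) is the mapping cone of y_i on K(y'), *)
(* where y' omits y_i.                                                        *)
Section KoszulCone.
Variables (R : comNzRingType) (M : lmodType R) (n : nat) (i : 'I_n).
Implicit Types (J : {set 'I_n.-1}) (f : koszul n M) (g : koszul n.-1 M).

Definition lift_set J : {set 'I_n} := [set lift i l | l in J].
Definition unlift_set (J : {set 'I_n}) : {set 'I_n.-1} := [set l | lift i l \in J].
(** The number of transpositions that bring $e_i$ to the front of the basis element of
    [i |: lift_set J]. *)
Definition below J : nat := #|[set l in J | (lift i l < i)%N]|.

Lemma lift_setK : cancel lift_set unlift_set.
Proof. by move=> J; apply/setP => l; rewrite inE mem_imset //; exact: lift_inj. Qed.

Lemma notin_lift_set J : i \notin lift_set J.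
Proof. by apply/imsetP => -[l _ /eqP]; rewrite (negPf (neq_lift i l)). Qed.

Lemma mem_lift_set J l : (lift i l \in lift_set J) = (l \in J).
Proof. by rewrite mem_imset //; exact: lift_inj. Qed.

Lemma lift_setU J l : lift_set (l |: J) = lift i l |: lift_set J.
Proof. by rewrite /lift_set imsetU1. Qed.

Lemma unlift_setU1 J : unlift_set (i |: lift_set J) = J.
Proof.
by apply/setP => l; rewrite !inE eq_sym (negPf (neq_lift i l)) mem_lift_set.
Qed.

Lemma unlift_setK (J : {set 'I_n}) : i \notin J -> lift_set (unlift_set J) = J.
Proof.
move=> iJ; apply/setP => l; case: (unliftP i l) => [l' ->|->].
  by rewrite mem_lift_set inE.
by rewrite (negPf iJ) (negPf (notin_lift_set _)).
Qed.

Lemma unlift_setU1K (J : {set 'I_n}) : i \in J -> i |: lift_set (unlift_set J) = J.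
Proof.
move=> iJ; apply/setP => l; rewrite !inE; case: (unliftP i l) => [l' ->|->].
  by rewrite eq_sym (negPf (neq_lift i l')) mem_lift_set inE.
by rewrite eqxx iJ.
Qed.

Lemma card_lift_set J : #|lift_set J| = #|J|.
Proof. by rewrite card_imset //; exact: lift_inj. Qed.

Lemma card_lift_setU1 J : #|i |: lift_set J| = #|J|.+1.
Proof. by rewrite cardsU1 notin_lift_set card_lift_set. Qed.

Lemma ltn_lift (j l : 'I_n.-1) : (lift i j < lift i l)%N = (j < l)%N.
Proof. by rewrite !ltnNge /= leq_bump2. Qed.

Lemma below_lift J : #|[set l in lift_set J | (l < i)%N]| = below J.
Proof.
rewrite -[RHS]card_lift_set; apply: eq_card => l.
case: (unliftP i l) => [l' ->|->]; first by rewrite inE !mem_lift_set inE.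
by rewrite inE !(negPf (notin_lift_set _)).
Qed.

Lemma sign_lift J l :
  #|[set k in lift_set J | (k < lift i l)%N]| = #|[set k in J | (k < l)%N]|.
Proof.
rewrite -[RHS]card_lift_set; apply: eq_card => k.
case: (unliftP i k) => [k' ->|->]; first by rewrite inE !mem_lift_set inE ltn_lift.
by rewrite inE !(negPf (notin_lift_set _)).
Qed.

Lemma sign_liftU1 J l :
  #|[set k in i |: lift_set J | (k < lift i l)%N]| =
  ((i < lift i l) + #|[set k in J | (k < l)%N]|)%N.
Proof.
rewrite -sign_lift; case: ltnP => il.
  rewrite (_ : [set k in i |: _ | _] = i |: [set k in lift_set J | (k < lift i l)%N]).
    by rewrite cardsU1 inE (negPf (notin_lift_set J)).
  apply/setP => k; rewrite !inE; case: eqP => [->|//]; by rewrite il.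
apply: eq_card => k; rewrite !inE; case: eqP => [->|//].
by rewrite (negPf (notin_lift_set J)) ltnNge il.
Qed.

Lemma belowU1 J l : l \notin J -> below (l |: J) = ((lift i l < i) + below J)%N.
Proof.
move=> lJ; rewrite /below; case: ltnP => il.
  rewrite (_ : [set k in l |: _ | _] = l |: [set k in J | (lift i k < i)%N]).
    by rewrite cardsU1 inE (negPf lJ).
  apply/setP => k; rewrite !inE; case: eqP => [->|//]; by rewrite il.
apply: eq_card => k; rewrite !inE; case: eqP => [->|//].
by rewrite (negPf lJ) ltnNge il.
Qed.

Definition cone0 f : koszul n.-1 M := [ffun J => f (lift_set J)].
(** The sign is chosen so that $f=f_0+e_i\wedge f_1$, with $f_0$ and $f_1$ the values of [cone0] and
    [cone1]. *)
Definition cone1 f : koszul n.-1 M :=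
  [ffun J => (-1) ^+ below J *: f (i |: lift_set J)].
Definition cone g0 g1 : koszul n M :=
  [ffun J : {set 'I_n} => if i \in J
     then (-1) ^+ below (unlift_set J) *: (g1 : koszul n.-1 M) (unlift_set J)
     else (g0 : koszul n.-1 M) (unlift_set J)].

Lemma cone0_is_linear : linear cone0.
Proof. by move=> a f f'; apply/ffunP => J; rewrite !ffunE. Qed.
HB.instance Definition _ := GRing.isLinear.Build R (koszul n M) (koszul n.-1 M)
  *:%R cone0 cone0_is_linear.

Lemma cone1_is_linear : linear cone1.
Proof.
by move=> a f f'; apply/ffunP => J; rewrite !ffunE scalerDr !scalerA mulrC.
Qed.
HB.instance Definition _ := GRing.isLinear.Build R (koszul n M) (koszul n.-1 M)
  *:%R cone1 cone1_is_linear.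

Lemma signZK k (v : M) : (-1) ^+ k *: ((-1) ^+ k *: v) = v.
Proof. by rewrite scalerA -exprD addnn -mul2n exprM sqrrN !expr1n scale1r. Qed.

Lemma cone0K g0 g1 : cone0 (cone g0 g1) = g0.
Proof.
by apply/ffunP => J; rewrite !ffunE (negPf (notin_lift_set J)) lift_setK.
Qed.

Lemma cone1K g0 g1 : cone1 (cone g0 g1) = g1.
Proof.
by apply/ffunP => J; rewrite !ffunE !inE eqxx /= unlift_setU1 signZK.
Qed.

Lemma cone_inj f f' : cone0 f = cone0 f' -> cone1 f = cone1 f' -> f = f'.
Proof.
move=> /ffunP e0 /ffunP e1; apply/ffunP => J; case: (boolP (i \in J)) => iJ.
  have := e1 (unlift_set J); rewrite !ffunE unlift_setU1K //.
  by move/(congr1 (GRing.scale ((-1) ^+ below (unlift_set J)))); rewrite !signZK.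
by have := e0 (unlift_set J); rewrite !ffunE unlift_setK.
Qed.

Lemma cone_homog j f :
  koszul_homog j f = koszul_homog j (cone0 f) && koszul_homog (j - 1) (cone1 f).
Proof.
apply/koszul_homogP/andP => [fj|[/koszul_homogP f0 /koszul_homogP f1] J Jj].
  split; apply/koszul_homogP => J Jj; rewrite ffunE fj ?card_lift_set ?scaler0 //.
  by rewrite card_lift_setU1 => jE; apply: Jj; rewrite -jE -addn1 PoszD addrK.
case: (boolP (i \in J)) => iJ.
  have := f1 (unlift_set J); rewrite ffunE unlift_setU1K // => f1J.
  rewrite -[f J](signZK (below (unlift_set J))) f1J ?scaler0 //.
  move=> jE; apply: Jj; rewrite -(unlift_setU1K iJ) card_lift_setU1.
  by rewrite -addn1 PoszD jE subrK.
have := f0 (unlift_set J); rewrite ffunE unlift_setK // => -> //.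
by rewrite -card_lift_set unlift_setK.
Qed.

Variable y : 'I_n -> R.
Let y' := fun j : 'I_n.-1 => y (lift i j).

(** Together with [cone1_d] this is the cone differential $d(f_0+e_i\wedge
    f_1)=(d'f_0+y_if_1)-e_i\wedge d'f_1$. *)
Lemma cone0_d f : cone0 (koszul_d y f) = koszul_d y' (cone0 f) + y i *: cone1 f.
Proof.
apply/ffunP => J; rewrite !ffunE (bigD1_ord i) ?notin_lift_set //= addrC.
congr (_ + _); last by rewrite below_lift scalerA mulrC.
apply: eq_big => [l|l lJ]; first by rewrite mem_lift_set.
by rewrite !ffunE sign_lift lift_setU.
Qed.

Lemma cone1_d f : cone1 (koszul_d y f) = - koszul_d y' (cone1 f).
Proof.
apply/ffunP => J; rewrite !ffunE big_mkcond (bigD1_ord i) //= setU11 add0r.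
rewrite -big_mkcond scaler_sumr -sumrN.
apply: eq_big => [l|l].
  by rewrite in_setU1 eq_sym (negPf (neq_lift i l)) mem_lift_set.
rewrite in_setU1 eq_sym (negPf (neq_lift i l)) mem_lift_set /= => lJ.
rewrite !ffunE sign_liftU1 belowU1 // lift_setU setUCA !scalerA -scaleNr.
(* Exactly one of [i < lift i l] and [lift i l < i] holds: the first gives the extra sign on the
   left, the second cancels the minus on the right. *)
congr (_ *: _); rewrite /y'; have := neq_lift i l.
rewrite -val_eqE neq_ltn; case: ltngtP => //= _ _; rewrite ?add0n ?add1n ?exprS; ring.
Qed.

End KoszulCone.

(** By induction on the number of variables: in the cone the mixed terms $\pm y_id'f_1$ cancel. *)
Lemma koszul_dd (R : comNzRingType) (M : lmodType R) n (y : 'I_n -> R)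
    (f : koszul n M) : koszul_d y (koszul_d y f) = 0.
Proof.
elim: n => [|n IHn] in y f *.
  by apply/ffunP => J; rewrite !ffunE big_ord0.
apply: (@cone_inj _ _ _ ord0); last first.
  by rewrite !cone1_d linear0 linearN opprK /= IHn.
rewrite cone0_d cone1_d cone0_d linear0 linearD linearZ /= IHn scalerN add0r.
by rewrite subrr.
Qed.

Section KoszulHomology.
Variables (R : comNzRingType) (M : lmodType R) (n : nat) (y : 'I_n -> R).
Implicit Types (j : int) (f : koszul n M).

Lemma koszul_d_homog j f :
  koszul_homog (j + 1) f -> koszul_homog j (koszul_d y f).
Proof.
move=> /koszul_homogP fj; apply/koszul_homogP => J Jj.
rewrite ffunE big1 // => l lJ; rewrite fj ?scaler0 // cardsU1 lJ add1n.
by rewrite -addn1 PoszD => /addIr.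
Qed.

Definition cycle_pred j : {pred koszul n M} := koszul_cycle y j.
Definition boundary_pred j : {pred koszul n M} :=
  [pred f | `[< exists2 w, koszul_homog (j + 1) w & f = koszul_d y w >]].

Lemma cycle_predP j f :
  reflect (koszul_homog j f /\ koszul_d y f = 0) (f \in cycle_pred j).
Proof. by apply: (iffP andP) => -[? /eqP]. Qed.

Lemma boundary_cycle j : {subset boundary_pred j <= cycle_pred j}.
Proof.
move=> _ /asboolP[w wj ->]; apply/cycle_predP.
by split; [exact: koszul_d_homog|exact: koszul_dd].
Qed.

Lemma submod_closed_cycle j : submod_closed (cycle_pred j).
Proof. exact/GRing.subsemimod_closed_submod/koszul_cycle_closed. Qed.

Lemma submod_closed_boundary j : submod_closed (boundary_pred j).
Proof.
split=> [|a _ _ /asboolP[u uj ->] /asboolP[v vj ->]]; apply/asboolP.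
  by exists 0; rewrite ?linear0 //; apply/koszul_homogP => J; rewrite ffunE.
exists (a *: u + v); last by rewrite linearP.
apply/koszul_homogP => J Jj; rewrite !ffunE.
by rewrite (koszul_homogP _ _ uj) // (koszul_homogP _ _ vj) // scaler0 addr0.
Qed.

Section Degree.
Variable j : int.
Let Z := koszul_cycles y M j.
Let H := koszul_homology y M j.
Let I := GRing.SubmodClosed.clone R Z (@koszul_boundary R n y M j) _.
Let pi : {linear Z -> quotmod I} := quotmod_pi I.

Definition koszul_class f (fj : f \in cycle_pred j) : H := pi (KoszulCycle fj).

Lemma koszul_class_surj (h : H) : exists f (fj : f \in cycle_pred j), h = koszul_class fj.
Proof.
have [[f fj] ->] := quotmod_pi_surj h; exists f, fj.
by congr quotmod_pi; apply: val_inj.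
Qed.

Lemma koszul_class_eq0 f (fj : f \in cycle_pred j) :
  (koszul_class fj == 0) = (f \in boundary_pred j).
Proof. exact: quotmod_pi_eq0. Qed.

Lemma koszul_classD f g (fj : f \in cycle_pred j) (gj : g \in cycle_pred j)
    (fgj : f + g \in cycle_pred j) :
  koszul_class fgj = koszul_class fj + koszul_class gj.
Proof. by rewrite -[RHS]linearD; congr quotmod_pi; apply: val_inj. Qed.

Lemma koszul_classZ a f (fj : f \in cycle_pred j) (afj : a *: f \in cycle_pred j) :
  koszul_class afj = a *: koszul_class fj.
Proof. by rewrite -[RHS]linearZ; congr quotmod_pi; apply: val_inj. Qed.

Lemma koszul_class_irr f (fj fj' : f \in cycle_pred j) :
  koszul_class fj = koszul_class fj'.
Proof. by congr quotmod_pi; apply: val_inj. Qed.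

(** The maps [cone0] and [cone1] live on Koszul chains, so submodules of the homology are pulled
    back to submodules between boundaries and cycles. *)
Definition class_preim (T : {pred H}) : {pred koszul n M} :=
  [pred f | `[< exists fj : f \in cycle_pred j, koszul_class fj \in T >]].

Lemma colength_class_preim (T1 T2 : {pred H}) :
  submod_closed T1 -> submod_closed T2 -> {subset T1 <= T2} ->
  (finite_colength (class_preim T1) (class_preim T2) <-> finite_colength T1 T2) /\
  colength (class_preim T1) (class_preim T2) = colength T1 T2.
Proof.
move=> T1m T2m T12.
have E (T : {pred H}) :
    class_preim T = lin_image (val : {linear Z -> koszul n M}) (lin_preim pi T).
  apply/pred_ext => f; apply/asboolP/asboolP => [[fj fT]|[[g gj] gT ->]].
    by exists (KoszulCycle fj).
  exists gj; move: gT; rewrite inE /koszul_class.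
  by congr (_ \in _); congr quotmod_pi; apply: val_inj.
have [|fP cP] := colength_preim (f := pi) T1m T2m T12.
  exact: quotmod_pi_surj.
have [|fI cI] := @colength_image _ _ _ (val : {linear Z -> koszul n M}) _ _
    (submod_closed_preim pi T1m) (submod_closed_preim pi T2m)
    (fun v vT => T12 _ vT).
  move=> z /andP[_ /eqP z0]; have -> : z = 0 by apply: val_inj.
  by rewrite inE linear0 submod_closed0.
by rewrite !E -cI -cP; split=> //; rewrite -fI.
Qed.

Lemma class_preimT : class_preim predT = cycle_pred j.
Proof. by apply/pred_ext => f; apply/asboolP/idP => [[]//|fj]; exists fj. Qed.

Lemma class_preim0 : class_preim (pred1 0) = boundary_pred j.
Proof.
apply/pred_ext => f; apply/asboolP/idP => [[fj]|fb].
  by rewrite inE koszul_class_eq0.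
by exists (boundary_cycle fb); rewrite inE koszul_class_eq0.
Qed.

Lemma class_preim_colon0 a f :
  f \in class_preim (colon0 H a) <-> f \in cycle_pred j /\ a *: f \in boundary_pred j.
Proof.
have Zc (fj : f \in cycle_pred j) : a *: f \in cycle_pred j.
  exact: submod_closedZ (submod_closed_cycle j) fj.
split=> [/asboolP[fj]|[fj afj]].
  by rewrite mem_colon0 -(koszul_classZ _ (Zc fj)) koszul_class_eq0.
by apply/asboolP; exists fj; rewrite mem_colon0 -(koszul_classZ _ (Zc fj)) koszul_class_eq0.
Qed.

Lemma class_preim_scale a f :
  f \in class_preim (scale_image H a) <->
  exists2 z, z \in cycle_pred j & exists2 b, b \in boundary_pred j & f = b + a *: z.
Proof.
have Zm := submod_closed_cycle j.
split=> [/asboolP[fj /mem_scale_image[h hE]]|[z zj [b bj fE]]].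
  have [z [zj zE]] := koszul_class_surj h; exists z => //.
  have azj := submod_closedZ a Zm zj; have Nazj := submod_closedN Zm azj.
  have fzj := submod_closedBr Zm fj azj.
  exists (f - a *: z); last by rewrite subrK.
  rewrite -(koszul_class_eq0 fzj) (koszul_classD fj Nazj) hE zE.
  by rewrite -(koszul_classZ zj azj) -(koszul_classD azj Nazj (submod_closedBr Zm azj azj))
             koszul_class_eq0 subrr (submod_closed0 (submod_closed_boundary j)).
apply/asboolP; have bz := boundary_cycle bj; have azj := submod_closedZ a Zm zj.
subst f; exists (submod_closedDr Zm bz azj).
apply/mem_scale_image; exists (koszul_class zj).
rewrite (koszul_classD bz azj) (koszul_classZ zj azj) -[RHS]add0r; congr (_ + _).
by apply/eqP; rewrite koszul_class_eq0.
Qed.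

(** Transfers the identity of the determinant trick from $M$ to its Koszul homology. *)
Lemma koszul_homology_scale_eq a b : (forall v : M, a *: v = b *: v) ->
  forall h : H, a *: h = b *: h.
Proof.
move=> ab h; have [f [fj ->]] := koszul_class_surj h.
have Zm := submod_closed_cycle j.
have [afj bfj] := (submod_closedZ a Zm fj, submod_closedZ b Zm fj).
rewrite -(koszul_classZ fj afj) -(koszul_classZ fj bfj).
have E : a *: f = b *: f by apply/ffunP => J; rewrite !ffunE ab.
by move: afj bfj; rewrite E => ? ?; apply: koszul_class_irr.
Qed.

Lemma acc_koszul_homology : noetherian R -> fg_module M -> acc H.
Proof.
move=> /noetherian_acc accR [r [g gP]].
have accK : acc (koszul n M : lmodType R).
  pose gK (p : {set 'I_n} * 'I_r) : koszul n M :=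
    [ffun J => if J == p.1 then g p.2 else 0].
  apply: (acc_span (g := gK)) accR => f.
  have /choice[a aP] J : exists a : 'I_r -> R, f J = \sum_(k < r) a k *: g k.
    exact/gP.
  exists (fun p => a p.1 p.2); rewrite -(pair_bigA _ (fun J k => a J k *: gK (J, k))) /=.
  apply/ffunP => J; rewrite aP sum_ffunE (bigD1 J) //= sum_ffunE.
  rewrite [X in _ + X]big1 ?addr0 => [|J' /negPf J'J].
    by apply: eq_bigr => k _; rewrite !ffunE eqxx.
  rewrite sum_ffunE big1 // => k _.
  by rewrite !ffunE eq_sym J'J scaler0.
have accZ : acc (Z : lmodType R).
  apply: (acc_inj (f := (val : {linear Z -> koszul n M}))) accK.
  exact: val_inj.
by apply: (acc_surj (f := pi)) accZ; exact: quotmod_pi_surj.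
Qed.

Lemma koszul_homology_eq0 (h : H) : n%:Z < j -> h = 0.
Proof.
move=> nj; have [f [fj ->]] := koszul_class_surj h.
have /cycle_predP[/koszul_homogP f0 _] := fj.
apply/eqP; rewrite koszul_class_eq0 (_ : f = 0).
  exact: submod_closed0 (submod_closed_boundary j).
apply/ffunP => J; rewrite ffunE f0 // => jE; move: nj; rewrite -jE.
by rewrite ltz_nat ltnNge -[X in (_ <= X)%N]card_ord max_card.
Qed.

End Degree.
End KoszulHomology.

(** * Isolating one variable in the Euler characteristic *)

Section EulerCharacteristic.
Variables (R : comNzRingType) (M : lmodType R) (n : nat) (i : 'I_n) (y : 'I_n -> R).
Let y' := fun j : 'I_n.-1 => y (lift i j).
Let H j := koszul_homology y M j.
Let H' j := koszul_homology y' M j.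

Lemma cycle_cone j (f : koszul n M) : f \in cycle_pred y j <->
  [/\ koszul_homog j (cone0 i f), cone1 i f \in cycle_pred y' (j - 1)
    & koszul_d y' (cone0 i f) + y i *: cone1 i f = 0].
Proof.
split=> [/cycle_predP[fj df]|[f0 /cycle_predP[f1 df1] df0]].
  move: fj; rewrite (cone_homog i) => /andP[f0 f1]; split=> //; last first.
    by rewrite -cone0_d df linear0.
  apply/cycle_predP; split=> //; apply/eqP.
  by rewrite -oppr_eq0 -cone1_d df linear0.
apply/cycle_predP; split; first by rewrite (cone_homog i) f0.
apply: (@cone_inj _ _ _ i); first by rewrite cone0_d linear0.
by rewrite cone1_d df1 oppr0 linear0.
Qed.

Lemma koszul_homog0 j k : koszul_homog j (0 : koszul k M).
Proof. by apply/koszul_homogP => J; rewrite ffunE. Qed.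

Lemma koszul_homogN j k (f : koszul k M) : koszul_homog j f -> koszul_homog j (- f).
Proof. by move=> /koszul_homogP fj; apply/koszul_homogP => J ?; rewrite ffunE fj ?oppr0. Qed.

(** Multiplication by $y_i$ is null-homotopic through $e_i\wedge{-}$: for a cycle $f$,
    $y_if=d(e_i\wedge f)$, and $e_i\wedge f=e_i\wedge f_0$. *)
Lemma koszul_homology_annihilated j (h : H j) : y i *: h = 0.
Proof.
have [f [fj ->]] := koszul_class_surj h.
have yfj := submod_closedZ (y i) (submod_closed_cycle M y j) fj.
rewrite -(koszul_classZ fj yfj); apply/eqP; rewrite koszul_class_eq0; apply/asboolP.
have [f0 /cycle_predP[f1 df1] df0] := (cycle_cone _ _).1 fj.
exists (cone i 0 (cone0 i f)).
  by rewrite (cone_homog i) cone0K cone1K koszul_homog0 /= addrK.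
apply: (@cone_inj _ _ _ i); rewrite linearZ /=.
  by rewrite cone0_d cone0K cone1K linear0 add0r.
by apply/eqP; rewrite cone1_d cone1K -addr_eq0 addrC df0.
Qed.

(** A cycle $g$ of $y'$ extends to a cycle $f_0+e_i\wedge g$ exactly when $y_ig=-d'f_0$ is a
    boundary. *)
Lemma cone1_cycle j :
  lin_image (cone1 i : {linear koszul n M -> koszul n.-1 M}) (cycle_pred y j) =
  class_preim (colon0 (H' (j - 1)) (y i)).
Proof.
apply/pred_ext => g; apply/asboolP/idP => [[f /cycle_cone[f0 f1 df] ->]|].
  apply/class_preim_colon0; split=> //; apply/asboolP.
  exists (- cone0 i f); first by rewrite subrK koszul_homogN.
  by apply/eqP; rewrite linearN /= -addr_eq0 addrC df.
move=> /class_preim_colon0[gj /asboolP[w wj ygw]].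
exists (cone i (- w) g); last by rewrite /= cone1K.
apply/cycle_cone; rewrite cone0K cone1K; split=> //.
  by rewrite subrK in wj; apply: koszul_homogN.
by rewrite linearN /= ygw addNr.
Qed.

Lemma cone1_boundary j :
  lin_image (cone1 i : {linear koszul n M -> koszul n.-1 M}) (boundary_pred y j) =
  boundary_pred y' (j - 1).
Proof.
apply/pred_ext => g; apply/asboolP/asboolP => [[_ /asboolP[w + ->] ->]|[w wj ->]].
  rewrite (cone_homog i) addrK => /andP[_ w1]; exists (- cone1 i w).
    by rewrite subrK koszul_homogN.
  by rewrite /= cone1_d linearN.
exists (koszul_d y (cone i 0 (- w))); last by rewrite /= cone1_d cone1K linearN opprK.
apply/asboolP; exists (cone i 0 (- w)) => //.
rewrite (cone_homog i) cone0K cone1K koszul_homog0 addrK /= koszul_homogN //.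
by rewrite subrK in wj.
Qed.

Let K1 : {pred koszul n M} := lin_ker (cone1 i : {linear koszul n M -> koszul n.-1 M}).

Lemma cone0_cycle j :
  lin_image (cone0 i : {linear koszul n M -> koszul n.-1 M})
    [predI cycle_pred y j & K1] = cycle_pred y' j.
Proof.
apply/pred_ext => g; apply/asboolP/cycle_predP => [[f /andP[fj /eqP f1] ->]|[gj dg]].
  have [f0 _] := (cycle_cone _ _).1 fj.
  by rewrite /= in f1; rewrite f1 scaler0 addr0.
exists (cone i g 0); last by rewrite /= cone0K.
apply/andP; split; last by rewrite inE /= cone1K.
apply/cycle_cone; rewrite cone0K cone1K; split=> //.
  exact: submod_closed0 (submod_closed_cycle _ _ _).
by rewrite scaler0 dg addr0.
Qed.

(** The boundary $dw$ has no $e_i$ part exactly when $w_1$ is a cycle, and it is then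
    $d'w_0+y_iw_1$. *)
Lemma cone0_boundary j :
  lin_image (cone0 i : {linear koszul n M -> koszul n.-1 M})
    [predI boundary_pred y j & K1] = class_preim (scale_image (H' j) (y i)).
Proof.
apply/pred_ext => g; apply/asboolP/idP => [[f /andP[/asboolP[w wj ->] /eqP f1] ->]|].
  rewrite /= cone1_d in f1; apply/class_preim_scale.
  move: wj; rewrite (cone_homog i) addrK => /andP[w0 w1].
  exists (cone1 i w).
    by apply/cycle_predP; split=> //; apply/eqP; rewrite -oppr_eq0 f1.
  exists (koszul_d y' (cone0 i w)); last by rewrite /= cone0_d.
  by apply/asboolP; exists (cone0 i w).
move=> /class_preim_scale[z /cycle_predP[zj dz] [_ /asboolP[w wj ->] ->]].
exists (koszul_d y (cone i w z)); last by rewrite /= cone0_d cone0K cone1K.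
apply/andP; split; last by rewrite inE /= cone1_d cone1K dz oppr0.
apply/asboolP; exists (cone i w z) => //.
by rewrite (cone_homog i) cone0K cone1K addrK wj zj.
Qed.

(* From 0 -> H_j(y') / y_i H_j(y') -> H_j(y) -> (0 : y_i)_{H_{j-1}(y')} -> 0. *)
Lemma koszul_homology_length j : finite_length (H j) ->
  [/\ finite_colength (scale_image (H' j) (y i)) predT,
      finite_colength (pred1 0) (colon0 (H' (j - 1)) (y i))
    & mod_length (H j) = (colength (scale_image (H' j) (y i)) predT +
        colength (pred1 0%R) (colon0 (H' (j - 1)) (y i)))%N].
Proof.
move=> /finite_length_colength fH.
have sub0 k (N : {pred H' k}) : submod_closed N -> {subset pred1 0 <= N}.
  by move=> Nm v /eqP->; apply: submod_closed0.
have Bm := submod_closed_boundary M y j; have Zm := submod_closed_cycle M y j.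
have BZ := @boundary_cycle _ M _ y j.
have [f1 c1] := @colength_class_preim _ M _ y j (pred1 0) predT
  (submod_closed_pred1 _) (submod_closed_predT _) (fun _ _ => isT).
rewrite mod_length_colength -c1; move/f1: fH => {f1 c1}.
rewrite class_preim0 class_preimT => fBZ.
pose c : {linear koszul n M -> koszul n.-1 M} := cone1 i.
rewrite (colength_linear c Bm Zm BZ fBZ).
have [] := (finite_colength_linear c Bm Zm BZ).1 fBZ.
rewrite cone1_cycle cone1_boundary -(class_preim0 M y' (j - 1)).
have [f1 c1] := colength_class_preim (submod_closed_pred1 (H' (j - 1)))
  (submod_closed_colon0 (H' (j - 1)) (y i))
  (sub0 _ _ (submod_closed_colon0 (H' (j - 1)) (y i))).
rewrite f1 c1 {f1 c1}.
have Km : submod_closed K1 by apply: submod_closed_ker.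
have [||||f0 c0] := @colength_image _ _ _ (cone0 i : {linear koszul n M -> koszul n.-1 M})
  [predI boundary_pred y j & K1] [predI cycle_pred y j & K1].
- exact: submod_closedI.
- exact: submod_closedI.
- by move=> v /andP[vB vK]; apply/andP; split=> //; exact: BZ.
- move=> v /andP[/andP[_ /eqP v1] /eqP v0]; have -> : v = 0.
    by apply: (@cone_inj _ _ _ i); rewrite [LHS](v0, v1) linear0.
  by rewrite inE /= (submod_closed0 Bm) (submod_closed0 Km).
have [f1 c1] := colength_class_preim (submod_closed_scale_image (H' j) (y i))
  (submod_closed_predT (H' j)) (fun _ _ => isT).
by rewrite f0 c0 cone0_cycle cone0_boundary -(class_preimT M y' j) f1 c1.
Qed.

(** With $a_j$ and $b_j$ the lengths of $H_j(y')/y_iH_j(y')$ and of $(0:y_i)_{H_j(y')}$, the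
    homology has length $a_j+b_{j-1}$ and the multiplicity is $a_j-b_j$. The difference telescopes
    to $b_{k-1}\pm b_n$, and $b_n=0$ since $y'$ has only $n-1$ members. *)
Lemma euler_char_mult k : (k <= n)%N -> (forall j, finite_length (H j)) ->
  euler_char y M k =
    (colength (pred1 0) (colon0 (H' (k%:Z - 1)) (y i)))%:Z +
    \sum_(k <= j < n.+1) (-1) ^+ (j - k) * mult (H' j%:Z) (y i).
Proof.
move=> kn fH; rewrite /euler_char.
pose b (j : int) := (colength (pred1 0) (colon0 (H' j) (y i)))%:Z.
have bn : b n = 0.
  rewrite /b; have n1n : (n.-1%:Z < n%:Z)%R.
    by rewrite ltz_nat; case: (n) i => // -[].
  rewrite (_ : colon0 _ _ = pred1 0) ?colength_refl //; first exact: submod_closed_pred1.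
  by apply/pred_ext => h; rewrite !inE mem_colon0 (koszul_homology_eq0 h n1n) scaler0 !eqxx.
suff telescope l : (k <= l)%N ->
    \sum_(k <= j < l) (-1) ^+ (j - k) * (mod_length (H j%:Z))%:Z =
    b (k%:Z - 1) + \sum_(k <= j < l) (-1) ^+ (j - k) * mult (H' j%:Z) (y i)
      - (-1) ^+ (l - k) * b (l%:Z - 1).
  by rewrite telescope ?leqW // -addn1 PoszD addrK bn mulr0 subr0.
elim: l => [|l IHl].
  by rewrite leqn0 => /eqP->; rewrite !big_geq // subnn mul1r addr0 subrr.
rewrite leq_eqVlt => /orP[/eqP->|]; first by rewrite !big_geq // subnn mul1r addr0 subrr.
rewrite ltnS => kl; rewrite !big_nat_recr //= IHl // subSn //.
have [_ _ lenE] := koszul_homology_length (fH l).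
pose a := (colength (scale_image (H' l) (y i)) predT)%:Z.
have -> : (mod_length (H l))%:Z = a + b (l%:Z - 1) by rewrite lenE PoszD.
have -> : mult (H' l) (y i) = a - b l by [].
have -> : l.+1%:Z - 1 = l%:Z by rewrite -addn1 PoszD addrK.
rewrite exprS; move: a (b _) (b _) (b _) (\sum_(_ <= _ < _) _) ((-1) ^+ _).
move=> a b1 b2 b3 s e; ring.
Qed.

End EulerCharacteristic.

(** * Finiteness of the Koszul homology of powers of parameters *)

Section LocalNilpotence.
Variables (R : comNzRingType) (m : {pred R}).
Hypotheses (noeR : noetherian R) (m_local : local_ring m).

(** A proper ideal generated by $1-ra$ would, by the ascending chain condition, lie in a maximal
    ideal, which is $\mathfrak m$; then $1\in\mathfrak m$. *)
Lemma local_inv r a : a \in m -> exists s, s * (1 - r * a) = 1.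
Proof.
move=> am; have [m_max m_uniq] := m_local; have [[m0 m1 mP] _] := m_max.
pose J : {pred R} := [pred z | `[< exists s, z = s * (1 - r * a) >]].
apply: contrapT => no1.
have J1 : 1 \notin J by apply/asboolP => -[s sE]; apply: no1; exists s.
have Ji : idealr_closed J.
  split=> //; first by apply/asboolP; exists 0; rewrite mul0r.
  move=> c _ _ /asboolP[s ->] /asboolP[s' ->]; apply/asboolP.
  by exists (c * s + s'); ring.
pose P (S : {pred R^o}) := idealr_closed (S : {pred R}) /\ {subset J <= S}.
have [||S [[Si JS] Smax]] := acc_max (P := P) (S0 := (J : {pred R^o})) (noetherian_acc noeR).
- by split.
- by move=> S [[S0 _ SP] _]; split.
have Sm : S =i m.
  apply: m_uniq; split=> // T Ti ST; apply: Smax => //; split=> //.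
  by move=> z /JS/ST.
have : 1 - r * a \in m.
  by rewrite -Sm; apply: JS; apply/asboolP; exists 1; rewrite mul1r.
move=> /(mP r a _ am) => ram; case/negP: m1.
by rewrite -(subrK (r * a) 1) addrC ram.
Qed.

(** The submodules $Ra^sv$ cannot keep decreasing, so some $u=a^sv$ satisfies $u=rau$, and $1-ra$ is
    a unit. *)
Lemma finite_length_local_nilpotent (V : lmodType R) a (v : V) :
  finite_length V -> a \in m -> exists e, a ^+ e *: v = 0.
Proof.
move=> [l [_ lmax]] am.
(* The reversed exponent makes this an ascending chain, with one step more than the length [l]
   allows. *)
pose c j : {pred V} := [pred u | `[< exists r, u = (r * a ^+ (l.+1 - j)) *: v >]].
have cm j : submod_closed (c j).
  split=> [|r _ _ /asboolP[s ->] /asboolP[s' ->]]; apply/asboolP.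
    by exists 0; rewrite mul0r scale0r.
  by exists (r * s + s'); rewrite scalerA -scalerDl; congr (_ *: _); ring.
have cS j : (j < l.+1)%N -> {subset c j <= c j.+1}.
  move=> jl _ /asboolP[s ->]; apply/asboolP; exists (s * a).
  by rewrite subSS subSn // exprS mulrA.
have [j [jl cj]] : exists j, (j < l.+1)%N /\ {subset c j.+1 <= c j}.
  apply: contrapT => noj; suff /lmax : has_chain (fun S : {pred V} => submod_closed S) l.+1.
    by rewrite ltnn.
  exists c; split=> // j jl; split; first exact: cS.
  by move=> cj; apply: noj; exists j.
exists (l - j)%N; set u := _ *: v.
have /cj/asboolP[r ur] : u \in c j.+1.
  by apply/asboolP; exists 1; rewrite subSS mul1r.
have [s s1] := local_inv r am.
rewrite -[u]scale1r -s1 -scalerA scalerBl scale1r {1}ur subSn // exprS mulrA.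
by rewrite -scalerA -/u subrr scaler0.
Qed.

End LocalNilpotence.

Section DeterminantTrick.
Variables (R : comNzRingType) (d : nat) (x : 'I_d -> R).

Definition span_ideal : {pred R} :=
  [pred r | `[< exists c : 'I_d -> R, r = \sum_i c i * x i >]].

Lemma span_ideal_closed a u v : u \in span_ideal -> v \in span_ideal -> a * u + v \in span_ideal.
Proof.
move=> /asboolP[b ->] /asboolP[c ->]; apply/asboolP.
exists (fun i => a * b i + c i); rewrite mulr_sumr -big_split.
by apply: eq_bigr => i _; rewrite mulrDl mulrA.
Qed.

Lemma span_ideal0 : 0 \in span_ideal.
Proof. by apply/asboolP; exists (fun=> 0); rewrite big1 // => i _; rewrite mul0r. Qed.

Lemma congr_prod (J : Type) (s : seq J) (F G : J -> R) :
  (forall k, F k - G k \in span_ideal) -> \prod_(k <- s) F k - \prod_(k <- s) G k \in span_ideal.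
Proof.
move=> FG; elim: s => [|k s IH]; first by rewrite !big_nil subrr span_ideal0.
rewrite !big_cons; set p := \prod_(j <- s) _ in IH *; set q := \prod_(j <- s) _ in IH *.
have -> : F k * p - G k * q = p * (F k - G k) + (G k * (p - q) + 0) by ring.
by apply: span_ideal_closed => //; apply: span_ideal_closed => //; exact: span_ideal0.
Qed.

Lemma congr_det r (A B : 'M[R]_r) :
  (forall j k, A j k - B j k \in span_ideal) -> \det A - \det B \in span_ideal.
Proof.
move=> AB; rewrite /determinant -sumrB.
elim/big_ind: _ => [|u v uI vI|s _]; first exact: span_ideal0.
  by rewrite -[u]mul1r span_ideal_closed.
rewrite -mulrBr -[_ * _]addr0; apply: span_ideal_closed; last exact: span_ideal0.
by apply: congr_prod => k.
Qed.

(* Cayley-Hamilton: if b M is contained in (x) M, then det (b - C) kills M    *)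
(* for a matrix C with entries in (x).                                        *)
Lemma determinant_trick (M : lmodType R) b : fg_module M ->
  (forall v : M, exists w : 'I_d -> M, b *: v = \sum_i x i *: w i) ->
  exists N (c : 'I_d -> R), forall v : M, b ^+ N *: v = (\sum_i c i * x i) *: v.
Proof.
move=> [r [g gP]] bM.
have gen v : exists a : 'I_r -> R, v = \sum_k a k *: g k by apply/gP.
have /choice[C CP] j : exists C : 'I_r -> R,
    b *: g j = \sum_k C k *: g k /\ forall k, C k \in span_ideal.
  have [w ->] := bM (g j); have /choice[a aP] i := gen (w i).
  exists (fun k => \sum_i a i k * x i); split=> [|k]; last first.
    by apply/asboolP; exists (fun i => a i k).
  transitivity (\sum_i \sum_k (a i k * x i) *: g k).
    apply: eq_bigr => i _; rewrite {1}aP scaler_sumr.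
    by apply: eq_bigr => k _; rewrite scalerA mulrC.
  by rewrite exchange_big; apply: eq_bigr => k _; rewrite scaler_suml.
pose B : 'M[R]_r := b%:M - \matrix_(j, k) C j k.
have Bg j : \sum_k B j k *: g k = 0.
  transitivity (\sum_k (b *+ (j == k)) *: g k - \sum_k C j k *: g k).
    by rewrite -sumrB; apply: eq_bigr => k _; rewrite !mxE scalerBl.
  rewrite (bigD1 j) //= eqxx big1 ?addr0 => [|k /negPf kj].
    by rewrite (CP j).1 subrr.
  by rewrite eq_sym kj scale0r.
have detg k : \det B *: g k = 0.
  transitivity (\sum_l (\adj B *m B) k l *: g l).
    rewrite mul_adj_mx (bigD1 k) //= big1 ?addr0 => [|l /negPf lk].
      by rewrite !mxE eqxx.
    by rewrite !mxE eq_sym lk scale0r.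
  transitivity (\sum_j \adj B k j *: \sum_l B j l *: g l).
    under eq_bigr => l _ do rewrite mxE scaler_suml.
    rewrite exchange_big; apply: eq_bigr => j _; rewrite scaler_sumr.
    by apply: eq_bigr => l _; rewrite scalerA.
  by rewrite big1 // => j _; rewrite Bg scaler0.
have det0 (v : M) : \det B *: v = 0.
  have [a ->] := gen v; rewrite scaler_sumr big1 // => k _.
  by rewrite scalerA mulrC -scalerA detg scaler0.
have /congr_det : forall j k, (b%:M : 'M[R]_r) j k - B j k \in span_ideal.
  by move=> j k; rewrite !mxE subKr; exact: (CP j).2.
rewrite det_scalar => /asboolP[c cE]; exists r, c => v.
by rewrite -cE scalerBl det0 subr0.
Qed.

End DeterminantTrick.

Section NilpotentScalars.
Variables (R : comNzRingType) (V : lmodType R).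

Definition nil_scalar : {pred R} :=
  [pred r | `[< exists e, forall v : V, r ^+ e *: v = 0 >]].

Lemma nil_scalarM r s : s \in nil_scalar -> r * s \in nil_scalar.
Proof.
move=> /asboolP[e eP]; apply/asboolP; exists e => v.
by rewrite exprMn -scalerA eP scaler0.
Qed.

Lemma nil_scalarD r s : r \in nil_scalar -> s \in nil_scalar -> r + s \in nil_scalar.
Proof.
move=> /asboolP[e eP] /asboolP[f fP]; apply/asboolP; exists (e + f)%N => v.
rewrite exprDn scaler_suml big1 // => k _; rewrite -scalerMnl.
suff -> : (r ^+ (e + f - k) * s ^+ k) *: v = 0 by rewrite mul0rn.
have [fk|/ltnW kf] := leqP f k.
  by rewrite -scalerA -(subnK fk) exprD -scalerA fP !scaler0.
by rewrite mulrC -scalerA -addnBA // exprD mulrC -scalerA eP !scaler0.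
Qed.

Lemma nil_scalar_sum d (x c : 'I_d -> R) :
  (forall i, x i \in nil_scalar) -> \sum_i c i * x i \in nil_scalar.
Proof.
move=> xn; elim/big_ind: _ => [|u v|i _]; last exact: nil_scalarM.
  by apply/asboolP; exists 1 => v; rewrite scale0r.
exact: nil_scalarD.
Qed.

End NilpotentScalars.

Lemma koszul_homology_finite_length (R : comNzRingType) (m : {pred R})
    (M : lmodType R) d (x : 'I_d -> R) (n : 'I_d -> nat) (j : int) :
  noetherian R -> local_ring m -> fg_module M -> system_of_parameters m M x ->
  finite_length (koszul_homology (fun i => x i ^+ n i) M j).
Proof.
move=> noeR mloc fgM [_ xm fQ]; set H := koszul_homology _ _ _.
apply: (finite_length_nilpotent mloc.1) => //; first exact: acc_koszul_homology.
move=> a h am; have [r [g gP]] := fgM.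
have aM k : exists e, a ^+ e *: g k \in seq_submod x (M := M).
  have [e ae] := finite_length_local_nilpotent noeR mloc
    (quotmod_pi (GRing.SubmodClosed.clone R M (@seq_submod R d x M) _) (g k)) fQ am.
  by exists e; rewrite -(quotmod_pi_eq0 (GRing.SubmodClosed.clone R M (@seq_submod R d x M) _)) linearZ /= ae.
have /choice[e eP] := aM.
have xMm : submod_closed (seq_submod x (M := M)).
  exact/GRing.subsemimod_closed_submod/seq_submod_closed.
(* One exponent that works for all generators, so that $a^lM\subseteq(x)M$. *)
pose l := (\max_k e k)%N.
have [v|N [c cP]] := @determinant_trick _ _ x M (a ^+ l) fgM.
  have [b ->] := (gP v).1 isT; apply/asboolP.
  suff : a ^+ l *: \sum_(k < r) b k *: g k \in seq_submod x (M := M) by [].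
  rewrite scaler_sumr; apply: submod_closed_sum => // k _.
  rewrite scalerA mulrC -scalerA submod_closedZ //.
  by rewrite -(subnK (leq_bigmax k : e k <= l)%N) exprD -scalerA submod_closedZ.
have xn i : x i \in nil_scalar H.
  by apply/asboolP; exists (n i) => u; exact: koszul_homology_annihilated.
have /asboolP[f fP] := nil_scalar_sum c xn.
(* On [H] the scalar $a^{lN}$ acts as a combination of the $x_i$, which is nilpotent because each
   $x_i^{n_i}$ kills [H]. *)
have cH := koszul_homology_scale_eq (y := fun i => x i ^+ n i) (j := j) cP.
exists (l * N * f)%N; rewrite !exprM -(fP h) {fP}.
elim: f h => [//|f IHf] h.
by rewrite !exprSr -!scalerA cH IHf.
Qed.

(** * Separately affine functions *)

Section PolynomialFunctions.
Variable d : nat.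
Implicit Types (n b : 'I_d -> nat) (p : {mpoly rat[d]}).

Definition update n (i : 'I_d) (t : nat) : 'I_d -> nat :=
  fun j => if j == i then t else n j.

Lemma mpoly_slice p n i : exists q : {poly rat},
  forall t : nat, p.@[fun j => (update n i t j)%:R] = q.[t%:R].
Proof.
exists (\sum_(c <- msupp p) p@_c *:
  \prod_j (if j == i then 'X else (n j)%:R%:P) ^+ c j) => t.
rewrite mevalE horner_sum; apply: eq_bigr => c _; rewrite hornerZ horner_prod.
congr (_ * _); apply: eq_bigr => j _; rewrite horner_exp /update.
by case: eqP => _; rewrite ?hornerX ?hornerC.
Qed.

Lemma poly_eventually_const (q : {poly rat}) (c : rat) t0 :
  (forall t : nat, (t0 <= t)%N -> q.[t%:R] = c) -> q = c%:P.
Proof.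
move=> qc; apply/eqP; rewrite -subr_eq0; apply: contraT => q0.
pose rs := [seq (t0 + s)%:R : rat | s <- iota 0 (size (q - c%:P))].
have := @max_poly_roots _ _ rs q0; rewrite size_map size_iota ltnn; apply.
  apply/allP => _ /mapP[s _ ->].
  by rewrite rootE !hornerE qc ?leq_addr // subrr.
rewrite map_inj_uniq ?iota_uniq // => s s' /eqP.
by rewrite Num.Theory.eqr_nat eqn_add2l => /eqP.
Qed.

(** Variables are freed one at a time, the others staying frozen at [b]: freeing [i] interpolates
    linearly between the nodes [n0] and [n0.+1]. *)
Lemma multiaffine_polynomial (f : ('I_d -> nat) -> rat) (n0 : nat) :
  (forall i n, (forall j, (n0 <= n j)%N) ->
    exists a c : rat, forall t, (n0 <= t)%N -> f (update n i t) = a + t%:R * c) ->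
  exists p, forall n, (forall j, (n0 <= n j)%N) -> p.@[fun j => (n j)%:R] = f n.
Proof.
move=> f_aff; pose mix (s : seq 'I_d) n b : 'I_d -> nat := fun j => if j \in s then n j else b j.
suff H (s : seq 'I_d) b : (forall j, (n0 <= b j)%N) -> exists p, forall n,
    (forall j, (n0 <= n j)%N) -> p.@[fun j => (n j)%:R] = f (mix s n b).
  have [|p pP] := H (enum 'I_d) (fun=> n0); first by [].
  exists p => n nn0; rewrite pP //; congr f; apply/funext => j.
  by rewrite /mix mem_enum.
elim: s b => [|i s IHs] b bn0; first by exists (f b)%:MP => n _; rewrite mevalC.
have un0 t : (n0 <= t)%N -> forall j, (n0 <= update b i t j)%N.
  by move=> tn0 j; rewrite /update; case: eqP.
have [p0 p0P] := IHs (update b i n0) (un0 _ (leqnn _)).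
have [p1 p1P] := IHs (update b i n0.+1) (un0 _ (leqnSn _)).
have [is_|is_] := boolP (i \in s).
  have [p pP] := IHs b bn0; exists p => n nn0; rewrite pP //; congr f.
  by apply/funext => j; rewrite /mix inE; case: eqP => // ->; rewrite is_.
exists (p0 + ('X_i - n0%:R%:MP) * (p1 - p0)) => n nn0.
rewrite mevalD mevalM !mevalB mevalXU mevalC p0P // p1P //.
have mixE t : mix s n (update b i t) = update (mix s n b) i t.
  apply/funext => j; rewrite /mix /update; case: eqP => [->|//].
  by rewrite (negPf is_).
have -> : mix (i :: s) n b = update (mix s n b) i (n i).
  by apply/funext => j; rewrite /mix /update inE; case: eqP => [->|].
have [|a [c ac]] := f_aff i (mix s n b).
  by move=> j; rewrite /mix; case: ifP.
rewrite !mixE !ac // -addn1 natrD; ring.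
Qed.

End PolynomialFunctions.

(** * The equivalence *)

Theorem theorem1p1 (R : comNzRingType) (m : {pred R}) (M : lmodType R)
    (d : nat) (x : 'I_d -> R) (n0 k : nat) :
  noetherian R -> local_ring m -> fg_module M -> krull_dim M d ->
  system_of_parameters m M x -> (0 < n0)%N -> (k <= d)%N ->
  ((exists p : {mpoly rat[d]},
      forall n : 'I_d -> nat, (forall i, (n0 <= n i)%N) ->
        p.@[fun i => (n i)%:R] =
          (euler_char (fun i => x i ^+ n i) M k)%:~R)
   <->
   (forall (i : 'I_d) (n : 'I_d -> nat), (forall j, (n0 <= n j)%N) ->
      let H := koszul_homology
                 (fun j : 'I_d.-1 => x (lift i j) ^+ n (lift i j))
                 M (k%:Z - 1) in
      colon0 H (x i ^+ n i) =i colon0 H (x i ^+ n0))).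
Proof.
move=> noeR mloc fgM _ xsop _ kd.
pose y n j := x j ^+ n j.
pose H i n j := koszul_homology (fun l : 'I_d.-1 => y n (lift i l)) M j.
have fH n j : finite_length (koszul_homology (y n) M j).
  exact: koszul_homology_finite_length mloc fgM xsop.
have Hupd i n t j : koszul_homology
    (fun l => y (update n i t) (lift i l)) M j = H i n j.
  congr koszul_homology; apply/funext => l.
  by rewrite /y /update eq_sym (negPf (neq_lift i l)).
have yupd i n t : y (update n i t) i = x i ^+ t by rewrite /y /update eqxx.
(* The cokernel of $x_i^t$ is controlled by the full homology in degree $j$, its kernel by degree
   $j+1$. *)
have mult_fin i n j t : finite_mult (H i n j) (x i ^+ t).
  have [fi _ _] := koszul_homology_length i (fH (update n i t) j).
  have [_ + _] := koszul_homology_length i (fH (update n i t) (j + 1)).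
  by rewrite addrK; rewrite !Hupd !yupd in fi *.
have [c chiE] : exists c : 'I_d -> ('I_d -> nat) -> int, forall i n t,
    euler_char (y (update n i t)) M k =
      (colength (pred1 0) (colon0 (H i n (k%:Z - 1)) (x i ^+ t)))%:Z + t%:Z * c i n.
  exists (fun i n => \sum_(k <= j < d.+1) (-1) ^+ (j - k) * mult (H i n j) (x i)).
  move=> i n t; rewrite (euler_char_mult i kd (fH _)) Hupd yupd; congr (_ + _).
  rewrite mulr_sumr; apply: eq_bigr => j _; rewrite Hupd.
  by rewrite (multX t (mult_fin i n j)) mulrCA.
split=> [[p pP] i n nn0|colonE].
  rewrite /= -/(y n) -/(H i n (k%:Z - 1)); set N := H i n _.
  have accN : acc N by apply: acc_koszul_homology.
  have [t0 t0P] := colon0X_stable (x i) accN.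
  have [beta betaD] : exists beta : nat -> nat, forall t,
      colength (pred1 0) (colon0 N (x i ^+ t)) = beta t by eexists.
  have beta_t0 t : (t0 <= t)%N -> beta t = beta t0.
    by move=> t0t; rewrite -!betaD t0P.
  have [q qP] := mpoly_slice p n i.
  have qE t : (n0 <= t)%N -> (q - (c i n)%:~R *: 'X).[t%:R] = (beta t)%:R.
    move=> n0t; rewrite !hornerE -qP pP; last first.
      by move=> j; rewrite /update; case: eqP.
    rewrite -/(y (update n i t)) chiE betaD intrD intrM !pmulrn.
    ring.
  (* Values are known from [n0] on and are constant from [t0] on; the resulting identity of
     polynomials carries constancy back down to [n0]. *)
  have qC : q - (c i n)%:~R *: 'X = (beta t0)%:R%:P.
    apply: (@poly_eventually_const _ _ (maxn n0 t0)) => t.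
    by rewrite geq_max => /andP[n0t t0t]; rewrite (qE t n0t) (beta_t0 t t0t).
  have betaE t : (n0 <= t)%N -> beta t = beta t0.
    move=> n0t; apply/eqP; rewrite -(Num.Theory.eqr_nat rat) -(qE t n0t) qC.
    by rewrite hornerC.
  suff -> : colon0 N (x i ^+ n i) = colon0 N (x i ^+ n0) by [].
  have [_ fin] := mult_fin i n (k%:Z - 1) (n i).
  apply: (colon0X_eq (nn0 i) fin).
  by rewrite !betaD (betaE (n i) (nn0 i)) (betaE n0 (leqnn n0)).
have [//|p pP] := @multiaffine_polynomial _
    (fun n => (euler_char (y n) M k)%:~R) n0; last by exists p.
move=> i n nn0; pose N := H i n (k%:Z - 1).
exists (colength (pred1 0) (colon0 N (x i ^+ n0)))%:R, (c i n)%:~R => t n0t.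
have cE : colon0 N (x i ^+ t) = colon0 N (x i ^+ n0).
  have un0 j : (n0 <= update n i t j)%N by rewrite /update; case: eqP.
  (* The type of [colon0] depends on the module, so [Hupd] must rewrite both sides at once. *)
  pose P (L : lmodType R) := colon0 L (x i ^+ t) = colon0 L (x i ^+ n0).
  rewrite -/(P N) /N -(Hupd i n t); apply/pred_ext => v.
  by rewrite -(yupd i n t); exact: (colonE i (update n i t) un0 v).
by rewrite chiE cE intrD intrM -!pmulrn.
Qed.
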